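(* Let $f\ge 0$ be an integer and let $\mathcal{G}=(\mathcal{V},\mathcal{E})$ be a digraph with $n$ nodes. Consider the synchronous second-order agent network described in the context, in which every normal agent uses the DP-MSR algorithm with parameter $f$, and suppose $T>0$ and $\alpha>0$ satisfy $1+\frac{T^2}{2}\le \alpha T\le 2-\frac{T^2}{2}$. Then, under the $f$-total malicious model, the network reaches resilient consensus if and only if $\mathcal{G}$ is $(f+1,f+1)$-robust. Moreover, in that case the safety interval can be taken to be $$\mathcal{S}=\Big[\min_{i\notin\mathcal{M}}\hat{x}_i[0]+\min\Big\{0,\min_{i\notin\mathcal{M}}\big(T-\tfrac{\alpha T^2}{2}\big)v_i[0]\Big\},\ \max_{i\notin\mathcal{M}}\hat{x}_i[0]+\max\Big\{0,\max_{i\notin\mathcal{M}}\big(T-\tfrac{\alpha T^2}{2}\big)v_i[0]\Big\}\Big].$$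
   Context: Graphs. A digraph $\mathcal{G}=(\mathcal{V},\mathcal{E})$ has node set $\mathcal{V}=\{1,\dots,n\}$, $n>1$, and edge set $\mathcal{E}\subseteq\mathcal{V}\times\mathcal{V}$ without self-loops; $(j,i)\in\mathcal{E}$ means node $i$ receives information from node $j$. The neighbor set of $i$ is $\mathcal{N}_i=\{j:(j,i)\in\mathcal{E}\}$. For $\mathcal{S}'\subseteq\mathcal{V}$ and integer $r$, let $\mathcal{X}^r_{\mathcal{S}'}$ be the set of nodes in $\mathcal{S}'$ having at least $r$ in-neighbors outside $\mathcal{S}'$. The digraph is $(r,s)$-robust if for every pair of nonempty disjoint subsets $\mathcal{S}_1,\mathcal{S}_2\subset\mathcal{V}$ at least one holds: (1) $\mathcal{X}^r_{\mathcal{S}_1}=\mathcal{S}_1$; (2) $\mathcal{X}^r_{\mathcal{S}_2}=\mathcal{S}_2$; (3) $|\mathcal{X}^r_{\mathcal{S}_1}|+|\mathcal{X}^r_{\mathcal{S}_2}|\ge s$. A graph is $r$-robust if it is $(r,1)$-robust. Weights. Fix $\gamma>0$ and weights $a_{ij}\in[\gamma,1)$ for $(j,i)\in\mathcal{E}$ with $\sum_{j\in\mathcal{N}_i}a_{ij}\le 1$ for every $i$. Agents. Each agent $i$ has position $\hat{x}_i[k]\in\mathbb{R}$ (position minus a constant formation offset) and velocity $v_i[k]\in\mathbb{R}$, $k\in\mathbb{Z}_+$, with sampled double-integrator dynamics $\hat{x}_i[k+1]=\hat{x}_i[k]+Tv_i[k]+\frac{T^2}{2}u_i[k]$, $v_i[k+1]=v_i[k]+Tu_i[k]$,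 where $T>0$ is the sampling period. A subset $\mathcal{M}\subset\mathcal{V}$ of agents is malicious: their inputs $u_i[k]$ are arbitrary (they may know everything, including other agents' states, and may collude). All other agents are normal and use $u_i[k]=-\sum_{j\in\mathcal{N}_i}a_{ij}[k](\hat{x}_i[k]-\hat{x}_j[k])-\alpha v_i[k]$ with $\alpha>0$, where $a_{ij}[k]$ is given by the DP-MSR algorithm. DP-MSR algorithm (parameter $f$), synchronous: at each time $k$, each normal agent $i$ considers the relative positions $\hat{x}_j[k]-\hat{x}_i[k]$, $j\in\mathcal{N}_i$. If fewer than $f$ neighbors have relative value $\ge 0$, it ignores all of those neighbors; otherwise it ignores $f$ neighbors with the largest relative values. Similarly, if fewer than $f$ neighbors have relative value $\le 0$, it ignores all of those; otherwise it ignores $f$ neighbors with the smallest relative values. Then $a_{ij}[k]=0$ for ignored neighbors $j$ and $a_{ij}[k]=a_{ij}$ for the other neighbors. Malicious models. The network is $f$-total malicious if $|\mathcal{M}|\le f$; it is $f$-local malicious if $|\mathcal{N}_i\cap\mathcal{M}|\le f$ for every normal agent $i$. Resilient consensus. The network reaches resilient consensus if for every admissible malicious set $\mathcal{M}$ (under the model considered), all initial positions and velocities, and all malicious inputs: (Safety) there is a bounded interval $\mathcal{S}$ depending only on the initial positions and velocities of the normal agents with $\hat{x}_i[k]\in\mathcal{S}$ for all normal $i$ and all $k\in\mathbb{Z}_+$; (Agreement) there exists $c\in\mathcal{S}$ with $\lim_{k\to\infty}\hat{x}_i[k]=c$ and $\lim_{k\to\infty}v_i[k]=0$ for all normal $i$.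 *)

(* Defs.v *)
From Stdlib Require Import Reals List Arith Bool.
Import ListNotations.
Open Scope R_scope.
Open Scope bool_scope.
Open Scope R_scope.

Definition Rleb (a b : R) : bool := if Rle_dec a b then true else false.

(* Digraph on nodes 0..n-1: E j i = true means (j,i) is an edge, i.e. i receives from j. *)
Definition nodes (n : nat) : list nat := seq 0 n.

Definition nbrs (E : nat -> nat -> bool) (n i : nat) : list nat :=
  filter (fun j => E j i) (nodes n).

Definition card (n : nat) (S : nat -> bool) : nat := length (filter S (nodes n)).

Definition sumR (l : list R) : R := fold_right Rplus 0 l.

Definition out_in_count (E : nat -> nat -> bool) (n : nat) (S : nat -> bool) (i : nat) : nat :=
  length (filter (fun j => E j i && negb (S j)) (nodes n)).

Definition Xr (E : nat -> nat -> bool) (n r : nat) (S : nat -> bool) (i : nat) : bool :=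
  S i && Nat.leb r (out_in_count E n S i).

Definition robust (E : nat -> nat -> bool) (n r s : nat) : Prop :=
  forall S1 S2 : nat -> bool,
    (exists i, (i < n)%nat /\ S1 i = true) ->
    (exists i, (i < n)%nat /\ S2 i = true) ->
    (forall i, (i < n)%nat -> S1 i = true -> S2 i = false) ->
    (forall i, (i < n)%nat -> S1 i = true -> Xr E n r S1 i = true) \/
    (forall i, (i < n)%nat -> S2 i = true -> Xr E n r S2 i = true) \/
    (s <= card n (Xr E n r S1) + card n (Xr E n r S2))%nat.

Definition digraph_ok (E : nat -> nat -> bool) (n : nat) : Prop :=
  (1 < n)%nat /\ (forall i, E i i = false).

(* Standing assumptions on the weights a i j (weight of edge (j,i)) *)
Definition weights_ok (E : nat -> nat -> bool) (n : nat) (gamma : R) (a : nat -> nat -> R) : Prop :=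
  0 < gamma /\
  (forall i j, (i < n)%nat -> (j < n)%nat -> E j i = true -> gamma <= a i j < 1) /\
  (forall i, (i < n)%nat -> sumR (map (fun j => a i j) (nbrs E n i)) <= 1).

(* DP-MSR rule: ign is the set of neighbours ignored by normal agent i when the
   positions at the current time are xk.  Ties are broken arbitrarily: ign is any
   set compatible with the rule (upper part `up`, lower part `lo`). *)
Definition dpmsr_ignore (E : nat -> nat -> bool) (n f : nat) (xk : nat -> R) (i : nat)
    (ign : nat -> bool) : Prop :=
  let rel j := xk j - xk i in
  let Pl := filter (fun j => Rleb 0 (rel j)) (nbrs E n i) in
  let Ll := filter (fun j => Rleb (rel j) 0) (nbrs E n i) in
  exists up lo : nat -> bool,
    (forall j, In j (nbrs E n i) -> ign j = up j || lo j) /\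
    (forall j, In j (nbrs E n i) -> up j = true -> In j Pl) /\
    length (filter up Pl) = Nat.min f (length Pl) /\
    (forall j j', In j Pl -> In j' Pl -> up j = true -> up j' = false -> rel j' <= rel j) /\
    (forall j, In j (nbrs E n i) -> lo j = true -> In j Ll) /\
    length (filter lo Ll) = Nat.min f (length Ll) /\
    (forall j j', In j Ll -> In j' Ll -> lo j = true -> lo j' = false -> rel j <= rel j').

(* An execution of the network: x k i, v k i, u k i are position (minus offset),
   velocity and input of agent i at time k.  Malicious agents (M i = true) have
   arbitrary inputs; normal agents use the DP-MSR control law. *)
Definition execution (E : nat -> nat -> bool) (n : nat) (a : nat -> nat -> R) (f : nat)
    (T alpha : R) (M : nat -> bool) (x v u : nat -> nat -> R) : Prop :=
  (forall k i, (i < n)%nat ->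
     x (S k) i = x k i + T * v k i + T ^ 2 / 2 * u k i /\
     v (S k) i = v k i + T * u k i) /\
  exists sel : nat -> nat -> nat -> bool,
    forall k i, (i < n)%nat -> M i = false ->
      dpmsr_ignore E n f (x k) i (sel k i) /\
      u k i = - sumR (map (fun j => (if sel k i j then 0 else a i j) * (x k i - x k j))
                          (nbrs E n i))
              - alpha * v k i.

Definition f_total (n f : nat) (M : nat -> bool) : Prop :=
  (card n M <= f)%nat /\ exists i, (i < n)%nat /\ M i = false.

Definition res_consensus_with (E : nat -> nat -> bool) (n : nat) (a : nat -> nat -> R)
    (f : nat) (T alpha : R)
    (lo hi : (nat -> bool) -> (nat -> R) -> (nat -> R) -> R) : Prop :=
  forall M, f_total n f M ->
  forall x v u, execution E n a f T alpha M x v u ->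
    (forall k i, (i < n)%nat -> M i = false ->
        lo M (x 0%nat) (v 0%nat) <= x k i <= hi M (x 0%nat) (v 0%nat)) /\
    (exists c, lo M (x 0%nat) (v 0%nat) <= c <= hi M (x 0%nat) (v 0%nat) /\
       forall i, (i < n)%nat -> M i = false ->
         Un_cv (fun k => x k i) c /\ Un_cv (fun k => v k i) 0).

Definition depends_on_normal (n : nat) (g : (nat -> bool) -> (nat -> R) -> (nat -> R) -> R) : Prop :=
  forall M x0 x0' v0 v0',
    (forall i, (i < n)%nat -> M i = false -> x0 i = x0' i /\ v0 i = v0' i) ->
    g M x0 v0 = g M x0' v0'.

Definition res_consensus (E : nat -> nat -> bool) (n : nat) (a : nat -> nat -> R)
    (f : nat) (T alpha : R) : Prop :=
  exists lo hi, depends_on_normal n lo /\ depends_on_normal n hi /\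
    res_consensus_with E n a f T alpha lo hi.

Definition Rmin_list (l : list R) : R :=
  match l with nil => 0 | y :: t => fold_right Rmin y t end.
Definition Rmax_list (l : list R) : R :=
  match l with nil => 0 | y :: t => fold_right Rmax y t end.

Definition normals (n : nat) (M : nat -> bool) : list nat :=
  filter (fun i => negb (M i)) (nodes n).

Definition S_lo (n : nat) (T alpha : R) (M : nat -> bool) (x0 v0 : nat -> R) : R :=
  Rmin_list (map x0 (normals n M)) +
  Rmin 0 (Rmin_list (map (fun i => (T - alpha * T ^ 2 / 2) * v0 i) (normals n M))).
Definition S_hi (n : nat) (T alpha : R) (M : nat -> bool) (x0 v0 : nat -> R) : R :=
  Rmax_list (map x0 (normals n M)) +
  Rmax 0 (Rmax_list (map (fun i => (T - alpha * T ^ 2 / 2) * v0 i) (normals n M))).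

(* Main.v *)
Require Import Defs.
From Stdlib Require Import Reals List Arith Bool Lia Lra Relations ClassicalEpsilon Classical.
Open Scope R_scope.

(** Eliminating the velocities gives, with [s[k]] the weighted disagreement of an agent at time
    [k], the recursion
    [x[k+2] = (2 - alpha T) x[k+1] + (alpha T - 1) x[k] - (T^2/2) (s[k+1] + s[k])],
    whose right-hand side is a convex combination of positions lying between those of the normal
    agents: a kept neighbour beyond all normal agents would come with [f] ignored ones at least as
    far out, all of them malicious.  Hence the range of the normal positions over two consecutive
    times never grows, which is safety, and agreement follows once it shrinks by a fixed factor
    over a fixed number of steps.

    For [f > 0] every agent with neighbours ignores at least one, so it gives its own last position
    a positive weight.  Consider the agents within [e] of the top and those within [e] of the
    bottom of the range.  Robustness yields a normal agent in one of the two sets that keeps a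
    neighbour from outside it and thus leaves it, while own weights prevent others from entering
    (with [e] scaled down at each step); so one of the sets runs out of normal agents.

    For [f = 0] the own weights may all vanish (e.g. [T = 1], [alpha = 3/2]).  Robustness then
    provides a root, and since every edge acts with delays one and two, the root influences every
    agent at all sufficiently large delays, which again shrinks the range.

    Conversely, if robustness fails for [S1] and [S2], let the few agents of [S1] and [S2] with
    [f + 1] in-neighbours outside their set be malicious and stand still; the two sets then keep
    two different constant positions. *)

(** * Booleans, node lists, counting by filters, finite sums *)

Lemma Rleb_true (a b : R) : Rleb a b = true <-> a <= b.
Proof. unfold Rleb; destruct (Rle_dec a b); split; congruence. Qed.

Lemma Rleb_false (a b : R) : Rleb a b = false <-> b < a.
Proof.
  unfold Rleb; destruct (Rle_dec a b); split; intros; try congruence; try lra.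
Qed.

Lemma in_nodes (n i : nat) : In i (nodes n) <-> (i < n)%nat.
Proof. unfold nodes; rewrite in_seq; lia. Qed.

Lemma in_nbrs (E : nat -> nat -> bool) (n i j : nat) :
  In j (nbrs E n i) <-> (j < n)%nat /\ E j i = true.
Proof. unfold nbrs; rewrite filter_In, in_nodes; tauto. Qed.

Lemma NoDup_nodes (n : nat) : NoDup (nodes n).
Proof. apply seq_NoDup. Qed.

Lemma NoDup_nbrs (E : nat -> nat -> bool) (n i : nat) : NoDup (nbrs E n i).
Proof. apply NoDup_filter, NoDup_nodes. Qed.

Lemma card_le (n : nat) (S : nat -> bool) : (card n S <= n)%nat.
Proof.
  unfold card. rewrite <- (length_seq n 0) at 2. apply filter_length_le.
Qed.

Lemma filter_length_incl (A : Type) (p q : A -> bool) (l m : list A) :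
  NoDup l ->
  (forall z, In z l -> p z = true -> In z m /\ q z = true) ->
  (length (filter p l) <= length (filter q m))%nat.
Proof.
  intros Hl H. apply NoDup_incl_length.
  - now apply NoDup_filter.
  - intros z Hz. apply filter_In in Hz. apply filter_In. now apply H.
Qed.

Lemma filter_length_incl_lt (A : Type) (p q : A -> bool) (l m : list A) (y : A) :
  NoDup l ->
  (forall z, In z l -> p z = true -> In z m /\ q z = true) ->
  In y m -> q y = true -> (In y l -> p y = false) ->
  (length (filter p l) < length (filter q m))%nat.
Proof.
  intros Hl H Hm Hq Hp.
  apply (NoDup_incl_length (l := y :: filter p l)).
  - constructor.
    + rewrite filter_In. intros [Hy Hpy]. rewrite Hp in Hpy by exact Hy. discriminate.
    + now apply NoDup_filter.
  - intros z [<- | Hz]; apply filter_In; [easy |].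
    apply filter_In in Hz. now apply H.
Qed.

Lemma filter_length_pos (A : Type) (p : A -> bool) (l : list A) :
  (0 < length (filter p l))%nat -> exists z, In z l /\ p z = true.
Proof.
  destruct (filter p l) as [| z t] eqn:Heq; simpl; [lia |].
  intros _. exists z. apply filter_In. rewrite Heq. now left.
Qed.

Lemma filter_length_orb (A : Type) (p q : A -> bool) (l : list A) :
  (length (filter (fun z => p z || q z) l) <=
   length (filter p l) + length (filter q l))%nat.
Proof.
  induction l as [| z l IH]; simpl; [lia |].
  destruct (p z), (q z); simpl; lia.
Qed.

Lemma filter_length_disjoint (A : Type) (p q r : A -> bool) (l : list A) :
  (forall z, In z l -> p z = true -> r z = true) ->
  (forall z, In z l -> q z = true -> r z = true) ->
  (forall z, In z l -> p z = true -> q z = false) ->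
  (length (filter p l) + length (filter q l) <= length (filter r l))%nat.
Proof.
  induction l as [| z l IH]; simpl; intros Hp Hq Hd; [lia |].
  assert (length (filter p l) + length (filter q l) <= length (filter r l))%nat
    by (apply IH; auto).
  specialize (Hp z (or_introl eq_refl)). specialize (Hq z (or_introl eq_refl)).
  specialize (Hd z (or_introl eq_refl)).
  destruct (p z); [rewrite Hp, Hd by easy; simpl; lia |].
  destruct (q z); [rewrite Hq by easy; simpl; lia |].
  destruct (r z); simpl; lia.
Qed.

Lemma sumR_map_lin (A : Type) (c d : R) (g h : A -> R) (l : list A) :
  sumR (map (fun z => c * g z + d * h z) l) = c * sumR (map g l) + d * sumR (map h l).
Proof. unfold sumR. induction l as [| z l IH]; simpl; [| rewrite IH]; ring. Qed.

Lemma sumR_map_nonneg (A : Type) (g : A -> R) (l : list A) :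
  (forall z, In z l -> 0 <= g z) -> 0 <= sumR (map g l).
Proof.
  unfold sumR. induction l as [| z l IH]; simpl; intros H; [lra |].
  assert (0 <= g z) by (apply H; now left).
  assert (0 <= fold_right Rplus 0 (map g l)) by (apply IH; intros; apply H; now right).
  lra.
Qed.

Lemma sumR_map_ge_term (A : Type) (g : A -> R) (l : list A) (y : A) :
  (forall z, In z l -> 0 <= g z) -> In y l -> g y <= sumR (map g l).
Proof.
  induction l as [| z l IH]; simpl; intros H Hy; [easy |].
  assert (Hz : 0 <= g z) by (apply H; now left).
  assert (Hl : 0 <= sumR (map g l)) by (apply sumR_map_nonneg; intros; apply H; now right).
  unfold sumR in *; simpl.
  destruct Hy as [-> | Hy]; [lra |].
  assert (g y <= fold_right Rplus 0 (map g l)) by (apply IH; auto).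
  lra.
Qed.

Lemma sumR_map_zero (A : Type) (g : A -> R) (l : list A) :
  (forall z, In z l -> g z = 0) -> sumR (map g l) = 0.
Proof.
  unfold sumR. induction l as [| z l IH]; simpl; intros H; [easy |].
  rewrite IH, H; [ring | now left | intros; apply H; now right].
Qed.

Lemma Rmin_list_le (l : list R) (y : R) : In y l -> Rmin_list l <= y.
Proof.
  destruct l as [| z t]; simpl; [easy |].
  induction t as [| w t IH]; simpl; [intros [-> | []]; lra |].
  intros [-> | [-> | Hy]].
  - apply Rle_trans with (1 := Rmin_r _ _). auto.
  - apply Rmin_l.
  - apply Rle_trans with (1 := Rmin_r _ _). auto.
Qed.

Lemma Rmax_list_ge (l : list R) (y : R) : In y l -> y <= Rmax_list l.
Proof.
  destruct l as [| z t]; simpl; [easy |].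
  induction t as [| w t IH]; simpl; [intros [-> | []]; lra |].
  intros [-> | [-> | Hy]].
  - apply Rle_trans with (2 := Rmax_r _ _). auto.
  - apply Rmax_l.
  - apply Rle_trans with (2 := Rmax_r _ _). auto.
Qed.

(** * The DP-MSR rule *)

(** Reflection exchanges the roles of [up] and [lo]. With [execution_opp] it turns every upper bound
    below into a lower bound. *)
Lemma dpmsr_ignore_opp (E : nat -> nat -> bool) (n f : nat) (xk : nat -> R) (i : nat)
    (ign : nat -> bool) :
  dpmsr_ignore E n f xk i ign -> dpmsr_ignore E n f (fun j => - xk j) i ign.
Proof.
  unfold dpmsr_ignore. cbv zeta.
  assert (HP : forall j, Rleb 0 (- xk j - - xk i) = Rleb (xk j - xk i) 0).
  { intros j. apply eq_true_iff_eq. rewrite !Rleb_true. lra. }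
  assert (HL : forall j, Rleb (- xk j - - xk i) 0 = Rleb 0 (xk j - xk i)).
  { intros j. apply eq_true_iff_eq. rewrite !Rleb_true. lra. }
  rewrite (filter_ext _ _ HP), (filter_ext _ _ HL).
  intros (up & lo & Hign & Hup & Hupn & Huptop & Hlo & Hlon & Hlobot).
  exists lo, up. repeat split; auto.
  - intros j Hj. rewrite orb_comm. auto.
  - intros j j' Hj Hj' H1 H2. specialize (Hlobot j j' Hj Hj' H1 H2). lra.
  - intros j j' Hj Hj' H1 H2. specialize (Huptop j j' Hj Hj' H1 H2). lra.
Qed.

(** Since [j] belongs to [Pl] but not to [up], the set [up] does not exhaust [Pl] and so has exactly
    [f] members. These are at least as far out as [j], and [j] itself is one more. *)
Lemma kept_above (E : nat -> nat -> bool) (n f : nat) (xk : nat -> R) (i : nat)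
    (ign : nat -> bool) (j : nat) :
  dpmsr_ignore E n f xk i ign -> In j (nbrs E n i) -> ign j = false -> xk i < xk j ->
  (f < length (filter (fun h => Rleb (xk j) (xk h)) (nbrs E n i)))%nat.
Proof.
  unfold dpmsr_ignore. cbv zeta.
  set (Pl := filter (fun h => Rleb 0 (xk h - xk i)) (nbrs E n i)).
  intros (up & lo & Hign & _ & Hupn & Htop & _) Hj Hk Hlt.
  assert (HjP : In j Pl).
  { apply filter_In. split; [easy |]. apply Rleb_true. lra. }
  assert (Hupj : up j = false).
  { rewrite Hign in Hk by exact Hj. now apply orb_false_iff in Hk. }
  assert (HPl : NoDup Pl) by apply NoDup_filter, NoDup_nbrs.
  assert (length (filter up Pl) < length Pl)%nat.
  { rewrite <- (filter_true Pl) at 2.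
    apply filter_length_incl_lt with (y := j); auto. }
  assert (length (filter up Pl) < length (filter (fun h => Rleb (xk j) (xk h)) (nbrs E n i)))%nat.
  { apply filter_length_incl_lt with (y := j); auto.
    - intros h Hh Huph. split; [now apply filter_In in Hh |].
      apply Rleb_true. specialize (Htop h j Hh HjP Huph Hupj). lra.
    - apply Rleb_true. lra. }
  lia.
Qed.

(** A kept neighbour beyond [hi] would bring more than [f] neighbours beyond [hi], all of them
    malicious. *)
Lemma kept_le (E : nat -> nat -> bool) (n f : nat) (M : nat -> bool) (xk : nat -> R) (i : nat)
    (ign : nat -> bool) (hi : R) (j : nat) :
  dpmsr_ignore E n f xk i ign -> (card n M <= f)%nat -> (i < n)%nat -> M i = false ->
  (forall h, (h < n)%nat -> M h = false -> xk h <= hi) ->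
  In j (nbrs E n i) -> ign j = false -> xk j <= hi.
Proof.
  intros Hd HM Hi HMi Hhi Hj Hk.
  destruct (Rle_or_lt (xk j) hi) as [| Hlt]; [easy | exfalso].
  assert (xk i < xk j) by (specialize (Hhi i Hi HMi); lra).
  pose proof (kept_above _ _ _ _ _ _ j Hd Hj Hk ltac:(assumption)) as Hc.
  assert (length (filter (fun h => Rleb (xk j) (xk h)) (nbrs E n i)) <= card n M)%nat.
  { apply filter_length_incl; [apply NoDup_nbrs |].
    intros h Hh Hle. apply in_nbrs in Hh. rewrite in_nodes. split; [easy |].
    apply Rleb_true in Hle. destruct (M h) eqn:HMh; [easy | exfalso].
    specialize (Hhi h (proj1 Hh) HMh). lra. }
  lia.
Qed.

(** Neighbours at or below [theta] lie strictly below [i], so only [lo] can ignore them, and [lo]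
    has at most [f] members. *)
Lemma exists_kept_below (E : nat -> nat -> bool) (n f : nat) (xk : nat -> R) (i : nat)
    (ign : nat -> bool) (theta : R) :
  dpmsr_ignore E n f xk i ign -> theta < xk i ->
  (f < length (filter (fun j => Rleb (xk j) theta) (nbrs E n i)))%nat ->
  exists j, In j (nbrs E n i) /\ ign j = false /\ xk j <= theta.
Proof.
  unfold dpmsr_ignore. cbv zeta.
  set (Ll := filter (fun h => Rleb (xk h - xk i) 0) (nbrs E n i)).
  intros (up & lo & Hign & Hup & _ & _ & Hlo & Hlon & _) Hi Hc.
  apply NNPP. intros Hno.
  assert (length (filter (fun j => Rleb (xk j) theta) (nbrs E n i)) <= length (filter lo Ll))%nat.
  { apply filter_length_incl; [apply NoDup_nbrs |].
    intros j Hj Hle. apply Rleb_true in Hle.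
    split; [apply filter_In; split; [easy |]; apply Rleb_true; lra |].
    destruct (lo j) eqn:Hloj; [easy | exfalso]. apply Hno. exists j.
    repeat split; auto. rewrite Hign, Hloj by exact Hj.
    destruct (up j) eqn:Hupj; [exfalso | easy].
    specialize (Hup j Hj Hupj). apply filter_In in Hup as [_ Hup].
    apply Rleb_true in Hup. lra. }
  lia.
Qed.

(** Here [p] marks the neighbours that may differ from [i]. A kept one that differs would need more
    than [f] neighbours at least as far out on its side, all of them marked. *)
Lemma kept_eq (E : nat -> nat -> bool) (n f : nat) (xk : nat -> R) (i : nat)
    (ign : nat -> bool) (p : nat -> bool) :
  dpmsr_ignore E n f xk i ign ->
  (forall j, In j (nbrs E n i) -> p j = false -> xk j = xk i) ->
  (length (filter p (nbrs E n i)) <= f)%nat ->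
  forall j, In j (nbrs E n i) -> ign j = false -> xk j = xk i.
Proof.
  intros Hd Hp Hc j Hj Hk.
  destruct (Rtotal_order (xk j) (xk i)) as [Hlt | [Heq | Hlt]]; [exfalso | easy | exfalso].
  - pose proof (kept_above _ _ _ _ _ _ j (dpmsr_ignore_opp _ _ _ _ _ _ Hd) Hj Hk) as Hf.
    cbv beta in Hf. specialize (Hf ltac:(lra)).
    assert (length (filter (fun h => Rleb (- xk j) (- xk h)) (nbrs E n i)) <=
            length (filter p (nbrs E n i)))%nat; [| lia].
    apply filter_length_incl; [apply NoDup_nbrs |].
    intros h Hh Hle. apply Rleb_true in Hle. split; [easy |].
    destruct (p h) eqn:Hph; [easy | exfalso]. specialize (Hp h Hh Hph). lra.
  - pose proof (kept_above _ _ _ _ _ _ j Hd Hj Hk Hlt) as Hf.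
    assert (length (filter (fun h => Rleb (xk j) (xk h)) (nbrs E n i)) <=
            length (filter p (nbrs E n i)))%nat; [| lia].
    apply filter_length_incl; [apply NoDup_nbrs |].
    intros h Hh Hle. apply Rleb_true in Hle. split; [easy |].
    destruct (p h) eqn:Hph; [easy | exfalso]. specialize (Hp h Hh Hph). lra.
Qed.

Lemma dpmsr_ignore_0 (E : nat -> nat -> bool) (n : nat) (xk : nat -> R) (i : nat)
    (ign : nat -> bool) (j : nat) :
  dpmsr_ignore E n 0 xk i ign -> In j (nbrs E n i) -> ign j = false.
Proof.
  unfold dpmsr_ignore. cbv zeta.
  intros (up & lo & Hign & Hup & Hupn & _ & Hlo & Hlon & _) Hj.
  rewrite Hign by exact Hj. simpl in Hupn, Hlon.
  apply length_zero_iff_nil in Hupn, Hlon.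
  apply orb_false_iff. split.
  - destruct (up j) eqn:Hu; [exfalso | easy].
    assert (HI := conj (Hup j Hj Hu) Hu). apply filter_In in HI. rewrite Hupn in HI. easy.
  - destruct (lo j) eqn:Hl; [exfalso | easy].
    assert (HI := conj (Hlo j Hj Hl) Hl). apply filter_In in HI. rewrite Hlon in HI. easy.
Qed.

(** Every neighbour lies in [Pl] or [Ll], and for [f > 0] a nonempty list of these loses at least
    one member. This is the source of the positive own weight. *)
Lemma exists_ignored (E : nat -> nat -> bool) (n f : nat) (xk : nat -> R) (i : nat)
    (ign : nat -> bool) (j : nat) :
  (0 < f)%nat -> dpmsr_ignore E n f xk i ign -> In j (nbrs E n i) ->
  exists h, In h (nbrs E n i) /\ ign h = true.
Proof.
  intros Hf. unfold dpmsr_ignore. cbv zeta.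
  set (Pl := filter (fun h => Rleb 0 (xk h - xk i)) (nbrs E n i)).
  set (Ll := filter (fun h => Rleb (xk h - xk i) 0) (nbrs E n i)).
  intros (up & lo & Hign & Hup & Hupn & _ & Hlo & Hlon & _) Hj.
  destruct (Rle_or_lt 0 (xk j - xk i)) as [Hle | Hlt].
  - assert (HjP : In j Pl) by (apply filter_In; split; [easy | now apply Rleb_true]).
    destruct (filter_length_pos _ up Pl) as (h & Hh & Hu).
    { rewrite Hupn. destruct Pl; [easy | simpl; lia]. }
    exists h. apply filter_In in Hh as [Hh _]. split; [easy |].
    now rewrite Hign, Hu by exact Hh.
  - assert (HjL : In j Ll) by (apply filter_In; split; [easy | apply Rleb_true; lra]).
    destruct (filter_length_pos _ lo Ll) as (h & Hh & Hl).
    { rewrite Hlon. destruct Ll; [easy | simpl; lia]. }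
    exists h. apply filter_In in Hh as [Hh _]. split; [easy |].
    rewrite Hign, Hl by exact Hh. apply orb_true_r.
Qed.

(** * Rooted graphs *)

Definition edge (E : nat -> nat -> bool) (n j i : nat) : Prop :=
  (j < n)%nat /\ (i < n)%nat /\ E j i = true.

Definition reach (E : nat -> nat -> bool) (n : nat) : nat -> nat -> Prop :=
  clos_refl_trans nat (edge E n).

(** Robustness quantifies over boolean sets, so reachability is decided classically. *)
Definition reachb (E : nat -> nat -> bool) (n j i : nat) : bool :=
  if excluded_middle_informative (reach E n j i) then true else false.

Lemma reachb_true (E : nat -> nat -> bool) (n j i : nat) :
  reachb E n j i = true <-> reach E n j i.
Proof.
  unfold reachb. destruct (excluded_middle_informative (reach E n j i)); split; congruence.
Qed.

Lemma ancestors_closed (E : nat -> nat -> bool) (n r i h : nat) :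
  (h < n)%nat -> (1 <= r)%nat -> Xr E n r (fun j => reachb E n j i) h = false.
Proof.
  intros Hh Hr. unfold Xr. apply andb_false_iff.
  destruct (reachb E n h i) eqn:Hb; [right | now left].
  apply Nat.leb_gt. apply Nat.lt_le_trans with 1%nat; [| easy].
  apply Nat.nle_gt. intros Hc.
  destruct (filter_length_pos _ _ _ Hc) as (j & Hj & Hbj).
  apply andb_true_iff in Hbj as [HE Hbj]. apply negb_true_iff in Hbj.
  apply in_nodes in Hj.
  enough (reachb E n j i = true) by congruence.
  apply reachb_true. apply reachb_true in Hb.
  apply rt_trans with h; [| exact Hb]. apply rt_step. easy.
Qed.

(* Two nodes without a common ancestor have disjoint ancestor sets, neither of which receives
   an edge from outside; so a node reaching as many others as possible reaches all of them. *)
Lemma root_exists (E : nat -> nat -> bool) (n : nat) :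
  (0 < n)%nat -> robust E n 1 1 ->
  exists r, (r < n)%nat /\ forall i, (i < n)%nat -> reach E n r i.
Proof.
  intros Hn Hrob.
  enough (H : forall m i, (i < n)%nat -> (n - card n (reachb E n i) <= m)%nat ->
    exists r, (r < n)%nat /\ forall i, (i < n)%nat -> reach E n r i)
    by (apply (H n 0%nat Hn); lia).
  (* [m] bounds the number of nodes that [i] fails to reach. *)
  induction m as [m IH] using lt_wf_ind. intros i Hi Hm.
  destruct (excluded_middle_informative (forall j, (j < n)%nat -> reach E n i j))
    as [Hall | Hnot]; [eauto |].
  apply not_all_ex_not in Hnot as [j Hj]. apply imply_to_and in Hj as [Hj Hij].
  destruct (excluded_middle_informative (exists h, (h < n)%nat /\ reach E n h i /\ reach E n h j))
    as [(h & Hh & Hhi & Hhj) | Hno].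
  - assert (card n (reachb E n i) < card n (reachb E n h))%nat.
    { apply filter_length_incl_lt with (y := j).
      - apply NoDup_nodes.
      - intros z Hz Hb. split; [easy |]. apply reachb_true. apply reachb_true in Hb.
        now apply rt_trans with i.
      - now apply in_nodes.
      - now apply reachb_true.
      - intros _. destruct (reachb E n i j) eqn:Hb; [| easy].
        apply reachb_true in Hb. contradiction. }
    assert (card n (reachb E n h) <= n)%nat by apply card_le.
    apply (IH (n - card n (reachb E n h))%nat) with h; lia.
  - exfalso.
    assert (Hnone : forall z, card n (Xr E n 1 (fun h => reachb E n h z)) = 0%nat).
    { intros z. unfold card. apply Nat.le_0_r, Nat.nlt_ge. intros Hc.
      apply filter_length_pos in Hc as (h & Hh & Hb). apply in_nodes in Hh.
      rewrite ancestors_closed in Hb; easy. }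
    destruct (Hrob (fun h => reachb E n h i) (fun h => reachb E n h j)) as [H | [H | H]].
    + exists i. split; [easy |]. apply reachb_true. apply rt_refl.
    + exists j. split; [easy |]. apply reachb_true. apply rt_refl.
    + intros h Hh Hb. apply reachb_true in Hb.
      destruct (reachb E n h j) eqn:Hbj; [exfalso | easy].
      apply reachb_true in Hbj. eauto.
    + specialize (H i Hi). rewrite ancestors_closed in H by easy.
      enough (false = true) by discriminate. apply H, reachb_true, rt_refl.
    + specialize (H j Hj). rewrite ancestors_closed in H by easy.
      enough (false = true) by discriminate. apply H, reachb_true, rt_refl.
    + rewrite !Hnone in H. lia.
Qed.

(* [infl E n r t i]: the position of [r] enters the position of [i] exactly [t] steps later
   with a positive weight, when no neighbour is ignored.  An edge acts with delay one and with
   delay two; an agent without neighbours remembers its own position. *)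
Inductive infl (E : nat -> nat -> bool) (n r : nat) : nat -> nat -> Prop :=
| infl_start : infl E n r 0 r
| infl_one t j i : infl E n r t j -> edge E n j i -> infl E n r (S t) i
| infl_two t j i : infl E n r t j -> edge E n j i -> infl E n r (S (S t)) i
| infl_own t : infl E n r t r -> nbrs E n r = nil -> infl E n r (S t) r.

(** [d] is the number of edges of a walk from [j] to [i]; choosing delay one or two on each edge
    realises every total from [d] to [2 * d]. *)
Lemma infl_walk (E : nat -> nat -> bool) (n r j i : nat) :
  reach E n j i ->
  exists d, forall t s, infl E n r t j -> (d <= s <= 2 * d)%nat -> infl E n r (t + s) i.
Proof.
  intros H. induction H as [j i He | j | j h i _ (d1 & IH1) _ (d2 & IH2)].
  - exists 1%nat. intros t s Ht Hs.
    assert (Hc : s = 1%nat \/ s = 2%nat) by lia. destruct Hc as [-> | ->].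
    + rewrite Nat.add_1_r. now apply infl_one with j.
    + replace (t + 2)%nat with (S (S t)) by lia. now apply infl_two with j.
  - exists 0%nat. intros t s Ht Hs. now replace (t + s)%nat with t by lia.
  - exists (d1 + d2)%nat. intros t s Ht Hs.
    (* The first walk takes as much of the delay as it can while leaving at least [d2] for the
       second. *)
    replace (t + s)%nat with (t + Nat.min (2 * d1) (s - d2) + (s - Nat.min (2 * d1) (s - d2)))%nat
      by lia.
    apply IH2; [apply IH1; [easy |] |]; lia.
Qed.

(* Along a cycle of length [L] the delays fill [L, 2L], so they leave no gap and no periodicity. *)
Lemma infl_root (E : nat -> nat -> bool) (n r : nat) :
  (r < n)%nat -> (forall i, (i < n)%nat -> reach E n r i) ->
  exists L, forall t, (L <= t)%nat -> infl E n r t r.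
Proof.
  intros Hr Hroot. destruct (nbrs E n r) as [| j l] eqn:HN.
  - exists 0%nat. intros t _. induction t; [constructor | now constructor].
  - assert (Hj : In j (nbrs E n r)) by (rewrite HN; now left).
    apply in_nbrs in Hj as [Hj HE].
    destruct (infl_walk E n r r j (Hroot j Hj)) as [d Hd].
    (* The walk from [r] to [j] is closed by the edge from [j] to [r], used with delay one for the
       shortest total and delay two for all others. *)
    assert (Hcyc : forall t s, infl E n r t r -> (S d <= s <= 2 * S d)%nat -> infl E n r (t + s) r).
    { intros t s Ht Hs. destruct (Nat.eq_dec s (S d)) as [-> | Hne].
      - rewrite <- plus_n_Sm. apply infl_one with j; [| easy]. apply Hd; [easy | lia].
      - replace (t + s)%nat with (S (S (t + (s - 2))))%nat by lia.
        apply infl_two with j; [| easy]. apply Hd; [easy | lia]. }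
    exists (S d). intros t. induction t as [t IH] using lt_wf_ind. intros Ht.
    destruct (le_gt_dec t (2 * S d)) as [Hle | Hgt].
    + apply (Hcyc 0%nat t); [constructor | lia].
    + replace t with (t - S d + S d)%nat by lia. apply Hcyc; [apply IH |]; lia.
Qed.

Lemma eventually_uniform (P : nat -> nat -> Prop) (n : nat) :
  (forall i, (i < n)%nat -> exists K, forall t, (K <= t)%nat -> P t i) ->
  exists K, forall i t, (i < n)%nat -> (K <= t)%nat -> P t i.
Proof.
  induction n as [| n IH]; intros H; [exists 0%nat; intros; lia |].
  destruct IH as [K1 H1]; [auto |]. destruct (H n) as [K2 H2]; [lia |].
  exists (Nat.max K1 K2). intros i t Hi Ht.
  destruct (Nat.eq_dec i n) as [-> | Hne]; [apply H2 | apply H1]; lia.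
Qed.

Lemma infl_all (E : nat -> nat -> bool) (n r : nat) :
  (r < n)%nat -> (forall i, (i < n)%nat -> reach E n r i) ->
  exists K, forall i t, (i < n)%nat -> (K <= t)%nat -> infl E n r t i.
Proof.
  intros Hr Hroot. apply eventually_uniform. intros i Hi.
  destruct (infl_root E n r Hr Hroot) as [L HL].
  destruct (infl_walk E n r r i (Hroot i Hi)) as [d Hd].
  exists (L + d)%nat. intros t Ht.
  replace t with (t - d + d)%nat by lia. apply Hd; [apply HL |]; lia.
Qed.

(** * Convergence of the normal agents *)

(** Dynamics and control law are odd in the state, so the mirror image of a run is a run. *)
Lemma execution_opp (E : nat -> nat -> bool) (n : nat) (a : nat -> nat -> R) (f : nat)
    (T alpha : R) (M : nat -> bool) (x v u : nat -> nat -> R) :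
  execution E n a f T alpha M x v u ->
  execution E n a f T alpha M (fun k i => - x k i) (fun k i => - v k i) (fun k i => - u k i).
Proof.
  intros [Hdyn [sel Hsel]]. split.
  - intros k i Hi. destruct (Hdyn k i Hi) as [-> ->]. split; ring.
  - exists sel. intros k i Hi HM. destruct (Hsel k i Hi HM) as [Hd ->]. split.
    + now apply dpmsr_ignore_opp.
    + rewrite (map_ext
        (fun j => (if sel k i j then 0 else a i j) * (- x k i - - x k j))
        (fun j => (-1) * ((if sel k i j then 0 else a i j) * (x k i - x k j)) + 0 * 0))
        by (intros; ring).
      rewrite (sumR_map_lin _ (-1) 0 _ (fun _ => 0)). ring.
Qed.

Definition within (n : nat) (M : nat -> bool) (xk : nat -> R) (lo hi : R) : Prop :=
  forall i, (i < n)%nat -> M i = false -> lo <= xk i <= hi.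

Definition below (n : nat) (M : nat -> bool) (xk : nat -> R) (hi : R) : Prop :=
  forall i, (i < n)%nat -> M i = false -> xk i <= hi.

Section Run.

Variables (E : nat -> nat -> bool) (n f : nat) (gamma : R) (a : nat -> nat -> R) (T alpha : R).
Hypothesis weights : weights_ok E n gamma a.
Hypothesis T_pos : 0 < T.
Hypothesis gains : 1 + T ^ 2 / 2 <= alpha * T <= 2 - T ^ 2 / 2.
Variable M : nat -> bool.
Hypothesis total : f_total n f M.

(** * The two-step recursion for the slack below an upper bound *)

Definition rate : R := T ^ 2 / 2 * Rmin gamma 1.

Lemma rate_pos : 0 < rate.
Proof.
  apply Rmult_lt_0_compat; [pose proof (pow_lt T 2 T_pos); lra |].
  destruct weights as [Hg _]. apply Rmin_glb_lt; lra.
Qed.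

(** The two ends of [gains] together force [T ^ 2 <= 1]. *)
Lemma rate_le_half : rate <= 1 / 2.
Proof.
  unfold rate. pose proof (pow_lt T 2 T_pos).
  assert (Rmin gamma 1 <= 1) by apply Rmin_r.
  assert (0 < Rmin gamma 1) by (destruct weights as [Hg _]; apply Rmin_glb_lt; lra).
  nra.
Qed.

Lemma rate_pow (t : nat) : 0 < rate ^ t <= 1.
Proof.
  pose proof rate_pos. pose proof rate_le_half.
  induction t as [| t IH]; simpl; nra.
Qed.

Definition wsum (s : nat -> bool) (i : nat) : R :=
  sumR (map (fun j => if s j then 0 else a i j) (nbrs E n i)).

(** The disagreement is measured from a common bound [hi] instead of from the agent, so that every
    term becomes nonnegative. *)
Definition kept_slack (s : nat -> bool) (xk : nat -> R) (hi : R) (i : nat) : R :=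
  sumR (map (fun j => (if s j then 0 else a i j) * (hi - xk j)) (nbrs E n i)).

Lemma kept_weight (s : nat -> bool) (i j : nat) :
  (i < n)%nat -> In j (nbrs E n i) ->
  0 <= (if s j then 0 else a i j) <= a i j /\ (s j = false -> gamma <= if s j then 0 else a i j).
Proof.
  intros Hi Hj. apply in_nbrs in Hj as [Hj HE].
  destruct weights as (Hg & Ha & _). specialize (Ha i j Hi Hj HE).
  destruct (s j); split; intros; try discriminate; lra.
Qed.

Lemma wsum_bounds (s : nat -> bool) (i : nat) : (i < n)%nat -> 0 <= wsum s i <= 1.
Proof.
  intros Hi. split.
  - apply sumR_map_nonneg. intros j Hj. now apply kept_weight.
  - destruct weights as (_ & _ & Hs). specialize (Hs i Hi).
    assert (0 <= sumR (map (fun j => 1 * a i j + (-1) * (if s j then 0 else a i j)) (nbrs E n i))).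
    { apply sumR_map_nonneg. intros j Hj. pose proof (kept_weight s i j Hi Hj) as [? _]. lra. }
    rewrite (sumR_map_lin _ 1 (-1) (fun j => a i j) (fun j => if s j then 0 else a i j)) in H.
    unfold wsum. lra.
Qed.

(** The weight of an ignored neighbour, at least [gamma], is missing from a total of at most 1.
    Without neighbours the sum is 0, and the cap at 1 in [Rmin gamma 1] covers this case, where
    nothing need bound [gamma] from above. *)
Lemma wsum_lt1 (s : nat -> bool) (xk : nat -> R) (i : nat) :
  (i < n)%nat -> dpmsr_ignore E n f xk i s -> (0 < f)%nat \/ nbrs E n i = nil ->
  wsum s i <= 1 - Rmin gamma 1.
Proof.
  intros Hi Hd Hor.
  assert (Hmin := Rmin_l gamma 1). assert (Hmin' := Rmin_r gamma 1).
  destruct (nbrs E n i) as [| j0 t] eqn:HN.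
  { unfold wsum. rewrite HN. simpl. lra. }
  destruct Hor as [Hf | ?]; [| discriminate].
  destruct (exists_ignored E n f xk i s j0 Hf Hd) as (h & Hh & Hs).
  { rewrite HN. now left. }
  destruct weights as (_ & Ha & Hsum). specialize (Hsum i Hi).
  assert (Hterm := sumR_map_ge_term _
    (fun j => 1 * a i j + (-1) * (if s j then 0 else a i j)) (nbrs E n i) h).
  rewrite (sumR_map_lin _ 1 (-1) (fun j => a i j) (fun j => if s j then 0 else a i j)) in Hterm. cbv beta in Hterm. rewrite Hs in Hterm.
  apply in_nbrs in Hh as Hh'. specialize (Ha i h Hi (proj1 Hh') (proj2 Hh')).
  unfold wsum. enough (1 * a i h + (-1) * 0 <= 1 * sumR (map (fun j => a i j) (nbrs E n i)) +
    (-1) * sumR (map (fun j => if s j then 0 else a i j) (nbrs E n i))) by lra.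
  apply Hterm; [| easy].
  intros j Hj. pose proof (kept_weight s i j Hi Hj) as [? _]. lra.
Qed.

(** By [kept_le] even malicious neighbours contribute nonnegative terms when kept, so any single
    term bounds the sum from below. *)
Lemma kept_slack_ge (s : nat -> bool) (xk : nat -> R) (hi : R) (i : nat) :
  (i < n)%nat -> M i = false -> dpmsr_ignore E n f xk i s -> below n M xk hi ->
  0 <= kept_slack s xk hi i /\
  forall j, In j (nbrs E n i) -> s j = false -> gamma * (hi - xk j) <= kept_slack s xk hi i.
Proof.
  intros Hi HM Hd Hhi.
  assert (Hnn : forall j, In j (nbrs E n i) -> 0 <= (if s j then 0 else a i j) * (hi - xk j)).
  { intros j Hj. pose proof (kept_weight s i j Hi Hj) as [Hw _]. destruct (s j) eqn:Hs; [lra |].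
    assert (xk j <= hi).
    { now apply (kept_le E n f M xk i s hi j Hd (proj1 total)). }
    apply Rmult_le_pos; lra. }
  split; [now apply sumR_map_nonneg |].
  intros j Hj Hs.
  apply Rle_trans with ((if s j then 0 else a i j) * (hi - xk j)).
  - pose proof (kept_weight s i j Hi Hj) as [_ Hw]. specialize (Hw Hs).
    assert (xk j <= hi).
    { now apply (kept_le E n f M xk i s hi j Hd (proj1 total)). }
    apply Rmult_le_compat_r; lra.
  - exact (sumR_map_ge_term _ (fun j => (if s j then 0 else a i j) * (hi - xk j)) _ j Hnn Hj).
Qed.

Lemma drive_eq (s : nat -> bool) (xk : nat -> R) (hi : R) (i : nat) :
  sumR (map (fun j => (if s j then 0 else a i j) * (xk i - xk j)) (nbrs E n i)) =
  kept_slack s xk hi i - wsum s i * (hi - xk i).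
Proof.
  rewrite (map_ext _
    (fun j => 1 * ((if s j then 0 else a i j) * (hi - xk j)) +
              (- (hi - xk i)) * (if s j then 0 else a i j))) by (intros; ring).
  rewrite sumR_map_lin. unfold kept_slack, wsum. ring.
Qed.

Section Execution.

Variables x v u : nat -> nat -> R.
Variable sel : nat -> nat -> nat -> bool.
Hypothesis dyn : forall k i, (i < n)%nat ->
  x (S k) i = x k i + T * v k i + T ^ 2 / 2 * u k i /\ v (S k) i = v k i + T * u k i.
Hypothesis ctrl : forall k i, (i < n)%nat -> M i = false ->
  dpmsr_ignore E n f (x k) i (sel k i) /\
  u k i = - sumR (map (fun j => (if sel k i j then 0 else a i j) * (x k i - x k j)) (nbrs E n i))
          - alpha * v k i.

(* Eliminating the velocity turns the dynamics into a two-step recursion; the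
   condition on [alpha * T] is exactly what makes its coefficients nonnegative. *)
Lemma slack_rec (hi : R) (k i : nat) :
  (i < n)%nat -> M i = false ->
  hi - x (S (S k)) i =
    (2 - alpha * T - T ^ 2 / 2 * wsum (sel (S k) i) i) * (hi - x (S k) i) +
    (alpha * T - 1 - T ^ 2 / 2 * wsum (sel k i) i) * (hi - x k i) +
    T ^ 2 / 2 * kept_slack (sel (S k) i) (x (S k)) hi i +
    T ^ 2 / 2 * kept_slack (sel k i) (x k) hi i.
Proof.
  intros Hi HM.
  destruct (ctrl (S k) i Hi HM) as [_ Hu1]. destruct (ctrl k i Hi HM) as [_ Hu0].
  destruct (dyn (S k) i Hi) as [Hx2 _]. destruct (dyn k i Hi) as [Hx1 Hv1].
  rewrite (drive_eq _ _ hi) in Hu1. rewrite (drive_eq _ _ hi) in Hu0.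
  set (w1 := wsum (sel (S k) i) i) in *. set (w0 := wsum (sel k i) i) in *.
  set (d1 := kept_slack (sel (S k) i) (x (S k)) hi i) in *.
  set (d0 := kept_slack (sel k i) (x k) hi i) in *.
  clearbody w1 w0 d1 d0.
  rewrite Hx2, Hu1, Hv1, Hx1, Hu0. field.
Qed.

(** All four terms of [slack_rec] are nonnegative, so each of them alone bounds the new slack from
    below. *)
Lemma slack_ge (hi : R) (k i : nat) :
  below n M (x k) hi -> below n M (x (S k)) hi -> (i < n)%nat -> M i = false ->
  x (S (S k)) i <= hi /\
  (forall j, In j (nbrs E n i) -> sel (S k) i j = false ->
     rate * (hi - x (S k) j) <= hi - x (S (S k)) i) /\
  (forall j, In j (nbrs E n i) -> sel k i j = false ->
     rate * (hi - x k j) <= hi - x (S (S k)) i) /\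
  ((0 < f)%nat \/ nbrs E n i = nil -> rate * (hi - x (S k) i) <= hi - x (S (S k)) i).
Proof.
  intros H0 H1 Hi HM.
  assert (Hrec := slack_rec hi k i Hi HM).
  destruct (ctrl (S k) i Hi HM) as [Hd1 _]. destruct (ctrl k i Hi HM) as [Hd0 _].
  pose proof (kept_slack_ge _ _ hi i Hi HM Hd1 H1) as [Hs1 Hj1].
  pose proof (kept_slack_ge _ _ hi i Hi HM Hd0 H0) as [Hs0 Hj0].
  pose proof (wsum_bounds (sel (S k) i) i Hi) as Hw1.
  pose proof (wsum_bounds (sel k i) i Hi) as Hw0.
  assert (Ht := pow_lt T 2 T_pos).
  specialize (H0 i Hi HM) as Hx0. specialize (H1 i Hi HM) as Hx1.
  set (tau := T ^ 2 / 2) in *.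
  set (p := 2 - alpha * T - tau * wsum (sel (S k) i) i) in *.
  set (q := alpha * T - 1 - tau * wsum (sel k i) i) in *.
  assert (Htau : 0 < tau) by (unfold tau; lra).
  (* The upper bound on [alpha * T] gives [Hp], the lower bound gives [Hq]. *)
  assert (Hp : tau - tau * wsum (sel (S k) i) i <= p) by (unfold p; lra).
  assert (Hq : tau - tau * wsum (sel k i) i <= q) by (unfold q; lra).
  assert (Hp0 : 0 <= p * (hi - x (S k) i)) by (apply Rmult_le_pos; nra).
  assert (Hq0 : 0 <= q * (hi - x k i)) by (apply Rmult_le_pos; nra).
  assert (Hts1 : 0 <= tau * kept_slack (sel (S k) i) (x (S k)) hi i)
    by (apply Rmult_le_pos; lra).
  assert (Hts0 : 0 <= tau * kept_slack (sel k i) (x k) hi i) by (apply Rmult_le_pos; lra).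
  assert (Hm := Rmin_l gamma 1).
  assert (Hkept : forall y d, y <= hi -> gamma * (hi - y) <= d -> rate * (hi - y) <= tau * d).
  { intros y d Hy Hd. unfold rate. fold tau. rewrite Rmult_assoc.
    apply Rmult_le_compat_l; [lra |]. apply Rle_trans with (2 := Hd).
    apply Rmult_le_compat_r; lra. }
  repeat split.
  - lra.
  - intros j Hj Hs.
    assert (Hjx : x (S k) j <= hi)
      by now apply (kept_le E n f M (x (S k)) i (sel (S k) i) hi j Hd1 (proj1 total)).
    specialize (Hkept _ _ Hjx (Hj1 j Hj Hs)). lra.
  - intros j Hj Hs.
    assert (Hjx : x k j <= hi)
      by now apply (kept_le E n f M (x k) i (sel k i) hi j Hd0 (proj1 total)).
    specialize (Hkept _ _ Hjx (Hj0 j Hj Hs)). lra.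
  - intros Hor.
    pose proof (wsum_lt1 _ _ i Hi Hd1 Hor) as Hw.
    assert (rate <= p).
    { unfold rate. fold tau. apply Rle_trans with (2 := Hp). nra. }
    assert (rate * (hi - x (S k) i) <= p * (hi - x (S k) i))
      by (apply Rmult_le_compat_r; lra).
    lra.
Qed.

Lemma below_forever (hi : R) (k t : nat) :
  below n M (x k) hi -> below n M (x (S k)) hi ->
  below n M (x (t + k)%nat) hi.
Proof.
  intros H0 H1.
  enough (below n M (x (t + k)%nat) hi /\ below n M (x (S (t + k))) hi) by tauto.
  induction t as [| t [IH0 IH1]]; simpl; split; auto.
  intros i Hi HM. now apply slack_ge.
Qed.

(** A one-step bound that still contains the velocity. It yields the velocity terms of the safety
    interval at time 1 and, read backwards, the bound on velocities in [velocity_le]. *)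
Lemma next_position_le (hi : R) (k i : nat) :
  below n M (x k) hi -> (i < n)%nat -> M i = false ->
  x (S k) i <= hi + (T - alpha * T ^ 2 / 2) * v k i.
Proof.
  intros H0 Hi HM.
  destruct (ctrl k i Hi HM) as [Hd Hu]. destruct (dyn k i Hi) as [Hx _].
  rewrite (drive_eq _ _ hi) in Hu.
  pose proof (kept_slack_ge _ _ hi i Hi HM Hd H0) as [Hs _].
  pose proof (wsum_bounds (sel k i) i Hi) as Hw.
  specialize (H0 i Hi HM). assert (Ht := pow_lt T 2 T_pos).
  rewrite Hx, Hu.
  set (w := wsum (sel k i) i) in *. set (d := kept_slack _ _ _ _) in *.
  clearbody w d. set (y := x k i) in *. set (v0 := v k i) in *.
  assert (0 <= (T ^ 2 / 2) * d) by (apply Rmult_le_pos; lra).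
  assert (T ^ 2 / 2 * w <= 1) by nra.
  assert (T ^ 2 / 2 * w * (hi - y) <= 1 * (hi - y)) by (apply Rmult_le_compat_r; lra).
  replace (y + T * v0 + T ^ 2 / 2 * (- (d - w * (hi - y)) - alpha * v0))
    with (y + (T - alpha * T ^ 2 / 2) * v0 - T ^ 2 / 2 * d + T ^ 2 / 2 * w * (hi - y)) by field.
  lra.
Qed.

End Execution.

Lemma exec_below (x v u : nat -> nat -> R) (hi : R) (k t : nat) :
  execution E n a f T alpha M x v u ->
  below n M (x k) hi -> below n M (x (S k)) hi -> below n M (x (t + k)%nat) hi.
Proof.
  intros [Hdyn [sel Hctrl]] H0 H1. exact (below_forever x v u sel Hdyn Hctrl hi k t H0 H1).
Qed.

Lemma own_step (x v u : nat -> nat -> R) (hi e : R) (k i : nat) :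
  execution E n a f T alpha M x v u ->
  below n M (x k) hi -> below n M (x (S k)) hi -> (i < n)%nat -> M i = false ->
  (0 < f)%nat \/ nbrs E n i = nil ->
  x (S k) i <= hi - e -> x (S (S k)) i <= hi - rate * e.
Proof.
  intros [Hdyn [sel Hctrl]] H0 H1 Hi HM Hor Hx.
  destruct (slack_ge x v u sel Hdyn Hctrl hi k i H0 H1 Hi HM) as (_ & _ & _ & Hown).
  specialize (Hown Hor). pose proof rate_pos. nra.
Qed.

(** An agent already at or below [hi - e] relies on its own weight; one strictly above keeps some
    neighbour at or below [hi - e]. *)
Lemma drop_step (x v u : nat -> nat -> R) (hi e : R) (k i : nat) :
  execution E n a f T alpha M x v u ->
  below n M (x k) hi -> below n M (x (S k)) hi -> (i < n)%nat -> M i = false ->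
  (0 < f)%nat ->
  (f < length (filter (fun j => Rleb (x (S k) j) (hi - e)) (nbrs E n i)))%nat ->
  x (S (S k)) i <= hi - rate * e.
Proof.
  intros Hex H0 H1 Hi HM Hf Hc.
  destruct (Rle_or_lt (x (S k) i) (hi - e)) as [Hle | Hlt].
  { apply (own_step x v u hi e k i); auto. }
  destruct Hex as [Hdyn [sel Hctrl]].
  destruct (slack_ge x v u sel Hdyn Hctrl hi k i H0 H1 Hi HM) as (_ & Hkept & _).
  destruct (exists_kept_below E n f (x (S k)) i (sel (S k) i) (hi - e)) as (j & Hj & Hs & Hx);
    auto.
  { now apply Hctrl. }
  specialize (Hkept j Hj Hs). pose proof rate_pos. nra.
Qed.

Lemma edge_step (x v u : nat -> nat -> R) (hi e : R) (k j i : nat) :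
  execution E n a f T alpha M x v u -> f = 0%nat ->
  below n M (x k) hi -> below n M (x (S k)) hi -> (i < n)%nat -> M i = false ->
  (j < n)%nat -> E j i = true ->
  (x (S k) j <= hi - e \/ x k j <= hi - e) -> x (S (S k)) i <= hi - rate * e.
Proof.
  intros [Hdyn [sel Hctrl]] Hf H0 H1 Hi HM Hj HE Hx.
  assert (HN : In j (nbrs E n i)) by now apply in_nbrs.
  destruct (slack_ge x v u sel Hdyn Hctrl hi k i H0 H1 Hi HM) as (_ & Hk1 & Hk0 & _).
  assert (Hs : forall t, sel t i j = false).
  { intros t. apply (dpmsr_ignore_0 E n (x t) i); [| easy].
    rewrite <- Hf. now apply Hctrl. }
  specialize (Hk1 j HN (Hs _)). specialize (Hk0 j HN (Hs _)).
  pose proof rate_pos. destruct Hx; nra.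
Qed.

(** * Contraction of the range of the normal positions *)

Definition squeezes (x : nat -> nat -> R) (K : nat) (c : R) : Prop :=
  forall k lo hi, within n M (x k) lo hi -> within n M (x (S k)) lo hi ->
  (forall s, (s <= 1)%nat -> below n M (x (s + K + k)%nat) (hi - c * (hi - lo))) \/
  (forall s, (s <= 1)%nat ->
     below n M (fun i => - x (s + K + k)%nat i) (- lo - c * (hi - lo))).

(** Malicious agents are included, because robustness speaks of in-neighbours outside the whole set;
    only [count_above] restricts to normal agents. *)
Definition above (xk : nat -> R) (hi e : R) (i : nat) : bool := negb (Rleb (xk i) (hi - e)).

Lemma above_true (xk : nat -> R) (hi e : R) (i : nat) :
  above xk hi e i = true <-> hi - e < xk i.
Proof. unfold above. rewrite negb_true_iff. apply Rleb_false. Qed.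

Lemma above_false (xk : nat -> R) (hi e : R) (i : nat) :
  above xk hi e i = false <-> xk i <= hi - e.
Proof. unfold above. rewrite negb_false_iff. apply Rleb_true. Qed.

Definition count_above (xk : nat -> R) (hi e : R) : nat :=
  card n (fun i => negb (M i) && above xk hi e i).

Lemma count_above_0 (xk : nat -> R) (hi e : R) :
  count_above xk hi e = 0%nat -> below n M xk (hi - e).
Proof.
  intros H0 i Hi HM. apply above_false.
  destruct (above xk hi e i) eqn:Ha; [exfalso | easy].
  apply length_zero_iff_nil in H0.
  assert (HI : In i (filter (fun i => negb (M i) && above xk hi e i) (nodes n))).
  { apply filter_In. rewrite in_nodes, HM, Ha. easy. }
  rewrite H0 in HI. easy.
Qed.

(** By [own_step] no normal agent enters the set once the margin is scaled by [rate]; by [drop_step]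
    an agent with [f + 1] in-neighbours outside leaves it. *)
Lemma count_above_step (x v u : nat -> nat -> R) (hi e : R) (k : nat) :
  execution E n a f T alpha M x v u -> (0 < f)%nat ->
  below n M (x k) hi -> below n M (x (S k)) hi ->
  (count_above (x (S (S k))) hi (rate * e) <= count_above (x (S k)) hi e)%nat /\
  forall i, (i < n)%nat -> M i = false -> Xr E n (f + 1) (above (x (S k)) hi e) i = true ->
  (count_above (x (S (S k))) hi (rate * e) < count_above (x (S k)) hi e)%nat.
Proof.
  intros Hex Hf H0 H1.
  assert (Hincl : forall i, In i (nodes n) ->
    negb (M i) && above (x (S (S k))) hi (rate * e) i = true ->
    In i (nodes n) /\ negb (M i) && above (x (S k)) hi e i = true).
  { intros i Hi Hb. split; [easy |]. apply in_nodes in Hi.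
    apply andb_true_iff in Hb as [HM Hb]. rewrite HM. simpl.
    apply negb_true_iff in HM.
    destruct (above (x (S k)) hi e i) eqn:Ha; [easy | exfalso].
    apply above_false in Ha. apply above_true in Hb.
    pose proof (own_step x v u hi e k i Hex H0 H1 Hi HM (or_introl Hf) Ha). lra. }
  split.
  - apply filter_length_incl; [apply NoDup_nodes | exact Hincl].
  - intros i Hi HM HX. apply andb_true_iff in HX as [Ha HX].
    apply Nat.leb_le in HX.
    apply filter_length_incl_lt with (y := i); [apply NoDup_nodes | exact Hincl | | |].
    + now apply in_nodes.
    + now rewrite HM, Ha.
    + intros _. rewrite HM. simpl. apply above_false.
      apply (drop_step x v u); auto.
      apply Nat.lt_le_trans with (out_in_count E n (above (x (S k)) hi e) i); [lia |].
      apply filter_length_incl; [apply NoDup_nodes |].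
      intros j Hj Hb. apply andb_true_iff in Hb as [HE Hb]. apply negb_true_iff in Hb.
      apply above_false in Hb. apply in_nodes in Hj.
      split; [now apply in_nbrs | now apply Rleb_true].
Qed.

Lemma count_above_pos (xk : nat -> R) (hi e : R) :
  count_above xk hi e <> 0%nat ->
  exists i, (i < n)%nat /\ M i = false /\ above xk hi e i = true.
Proof.
  intros Hp. destruct (filter_length_pos _ (fun i => negb (M i) && above xk hi e i) (nodes n))
    as (i & Hi & Hb).
  { unfold count_above, card in Hp. lia. }
  exists i. apply in_nodes in Hi. apply andb_true_iff in Hb as [HM Hb].
  now apply negb_true_iff in HM.
Qed.

(* At most [f] agents are malicious, so a robustness count of [f + 1] always hits a normal one. *)
Lemma robust_normal (S1 S2 : nat -> bool) :
  robust E n (f + 1) (f + 1) ->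
  (exists i, (i < n)%nat /\ M i = false /\ S1 i = true) ->
  (exists i, (i < n)%nat /\ M i = false /\ S2 i = true) ->
  (forall i, (i < n)%nat -> S1 i = true -> S2 i = false) ->
  exists i, (i < n)%nat /\ M i = false /\
    (Xr E n (f + 1) S1 i = true \/ Xr E n (f + 1) S2 i = true).
Proof.
  intros Hrob (i1 & Hi1 & HM1 & HS1) (i2 & Hi2 & HM2 & HS2) Hdisj.
  destruct (Hrob S1 S2) as [H | [H | H]]; eauto 6.
  apply NNPP. intros Hno.
  enough (card n (Xr E n (f + 1) S1) + card n (Xr E n (f + 1) S2) <= card n M)%nat
    by (destruct total; lia).
  apply filter_length_disjoint.
  - intros i Hi HX. apply in_nodes in Hi. destruct (M i) eqn:HM; [easy |].
    exfalso. apply Hno. eauto.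
  - intros i Hi HX. apply in_nodes in Hi. destruct (M i) eqn:HM; [easy |].
    exfalso. apply Hno. eauto.
  - intros i Hi HX. apply in_nodes in Hi. apply andb_true_iff in HX as [HX _].
    unfold Xr. now rewrite Hdisj.
Qed.

Lemma count_above_decreases (x v u : nat -> nat -> R) (lo hi e : R) (k : nat) :
  execution E n a f T alpha M x v u -> robust E n (f + 1) (f + 1) -> (0 < f)%nat ->
  within n M (x k) lo hi -> within n M (x (S k)) lo hi -> 2 * e <= hi - lo ->
  count_above (x (S k)) hi e <> 0%nat ->
  count_above (fun i => - x (S k) i) (- lo) e <> 0%nat ->
  (count_above (x (S (S k))) hi (rate * e) +
   count_above (fun i => - x (S (S k)) i) (- lo) (rate * e) <
   count_above (x (S k)) hi e + count_above (fun i => - x (S k) i) (- lo) e)%nat.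
Proof.
  intros Hex Hrob Hf H0 H1 He Hp1 Hp2.
  assert (Hup := count_above_step x v u hi e k Hex Hf
    (fun i Hi HM => proj2 (H0 i Hi HM)) (fun i Hi HM => proj2 (H1 i Hi HM))).
  assert (Hlow := count_above_step _ _ _ (- lo) e k (execution_opp _ _ _ _ _ _ _ _ _ _ Hex) Hf
    (fun i Hi HM => Ropp_le_contravar _ _ (proj1 (H0 i Hi HM)))
    (fun i Hi HM => Ropp_le_contravar _ _ (proj1 (H1 i Hi HM)))).
  cbv beta in Hlow.
  destruct (robust_normal (above (x (S k)) hi e) (above (fun i => - x (S k) i) (- lo) e) Hrob)
    as (i & Hi & HM & HX).
  - now apply count_above_pos.
  - now apply count_above_pos.
  (* The two sets are disjoint because [2 * e <= hi - lo]. *)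
  - intros i Hi Ha. apply above_true in Ha. apply above_false. lra.
  - destruct Hup as [Hup1 Hup2], Hlow as [Hlow1 Hlow2].
    destruct HX as [HX | HX]; [specialize (Hup2 i Hi HM HX) | specialize (Hlow2 i Hi HM HX)];
      lia.
Qed.

Lemma count_above_0_step (x v u : nat -> nat -> R) (hi e : R) (k : nat) :
  execution E n a f T alpha M x v u -> (0 < f)%nat ->
  below n M (x k) hi -> below n M (x (S k)) hi ->
  count_above (x (S k)) hi e = 0%nat -> count_above (x (S (S k))) hi (rate * e) = 0%nat.
Proof.
  intros Hex Hf H0 H1 Hz. pose proof (proj1 (count_above_step x v u hi e k Hex Hf H0 H1)). lia.
Qed.

(** The total [up t + dn t] starts at no more than [2 * n] and drops at each step while both counts
    are positive. A count that has reached 0 stays there, so one of them is 0 from time [2 * n + 1]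
    on. *)
Lemma squeezes_pos (x v u : nat -> nat -> R) :
  execution E n a f T alpha M x v u -> robust E n (f + 1) (f + 1) -> (0 < f)%nat ->
  squeezes x (2 * n + 2) (rate ^ (2 * n + 2) / 2).
Proof.
  intros Hex Hrob Hf k lo hi H0 H1.
  assert (Hexo := execution_opp _ _ _ _ _ _ _ _ _ _ Hex).
  assert (Hgap : lo <= hi).
  { destruct total as [_ (i & Hi & HM)]. specialize (H0 i Hi HM). lra. }
  set (e := (hi - lo) / 2).
  set (up := fun t => count_above (x (t + S k)%nat) hi (rate ^ t * e)).
  set (dn := fun t => count_above (fun i => - x (t + S k)%nat i) (- lo) (rate ^ t * e)).
  assert (Hhi : forall t, below n M (x (t + k)%nat) hi).
  { intros t. apply (exec_below x v u hi k t Hex).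
    - intros i Hi HM. now apply H0.
    - intros i Hi HM. now apply H1. }
  assert (Hlo : forall t, below n M (fun i => - x (t + k)%nat i) (- lo)).
  { intros t. apply (exec_below _ _ _ (- lo) k t Hexo); intros i Hi HM.
    - specialize (H0 i Hi HM). lra.
    - specialize (H1 i Hi HM). lra. }
  assert (Hup0 : forall t, up t = 0%nat -> up (S t) = 0%nat).
  { intros t Ht. unfold up in *. simpl. rewrite Rmult_assoc.
    rewrite <- (plus_n_Sm t k) in *.
    apply (count_above_0_step x v u hi (rate ^ t * e) (t + k) Hex Hf); auto.
    apply (Hhi (S t)). }
  assert (Hdn0 : forall t, dn t = 0%nat -> dn (S t) = 0%nat).
  { intros t Ht. unfold dn in *. simpl. rewrite Rmult_assoc.
    rewrite <- (plus_n_Sm t k) in *.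
    apply (count_above_0_step _ _ _ (- lo) (rate ^ t * e) (t + k) Hexo Hf); auto.
    apply (Hlo (S t)). }
  assert (Hdec : forall t, up t <> 0%nat -> dn t <> 0%nat -> (up (S t) + dn (S t) < up t + dn t)%nat).
  { intros t Hu Hd. unfold up, dn in *. simpl. rewrite Rmult_assoc.
    rewrite <- (plus_n_Sm t k) in *.
    apply (count_above_decreases x v u lo hi (rate ^ t * e) (t + k) Hex Hrob Hf); auto.
    - intros i Hi HM. specialize (Hhi t i Hi HM). specialize (Hlo t i Hi HM). simpl in *. lra.
    - intros i Hi HM. specialize (Hhi (S t) i Hi HM). specialize (Hlo (S t) i Hi HM).
      simpl in *. lra.
    - pose proof (rate_pow t). unfold e. nra. }
  assert (Hend : forall t, (up t + dn t + t <= 2 * n)%nat \/ up t = 0%nat \/ dn t = 0%nat).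
  { induction t as [| t [IH | [IH | IH]]].
    - left. unfold up, dn, count_above.
      pose proof (card_le n (fun i => negb (M i) && above (x (0 + S k)%nat) hi (rate ^ 0 * e) i)).
      pose proof (card_le n (fun i => negb (M i) &&
        above (fun i => - x (0 + S k)%nat i) (- lo) (rate ^ 0 * e) i)).
      lia.
    - destruct (Nat.eq_dec (up t) 0) as [Hz | Hnz]; [auto |].
      destruct (Nat.eq_dec (dn t) 0) as [Hz' | Hnz']; [auto |].
      specialize (Hdec t Hnz Hnz'). left. lia.
    - auto.
    - auto. }
  (* The factor 1/2 comes from [e]; the exponent is the one needed at the later of the two times,
     [s = 1]. *)
  assert (Hpow : forall s, (s <= 1)%nat ->
    rate ^ (2 * n + 2) / 2 * (hi - lo) <= rate ^ (s + (2 * n + 1)) * e).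
  { intros s Hs. replace (2 * n + 2)%nat with ((1 - s) + (s + (2 * n + 1)))%nat by lia.
    rewrite (pow_add rate (1 - s)).
    pose proof (rate_pow (1 - s)). pose proof (rate_pow (s + (2 * n + 1))).
    unfold e.
    assert (0 <= rate ^ (s + (2 * n + 1)) * ((hi - lo) / 2)) by (apply Rmult_le_pos; lra).
    nra. }
  destruct (Hend (2 * n + 1)%nat) as [Habs | [Hz | Hz]]; [lia | left | right];
    intros s Hs i Hi HM; specialize (Hpow s Hs);
    replace (s + (2 * n + 2) + k)%nat with (s + (2 * n + 1) + S k)%nat by lia.
  - assert (Hzs : up (s + (2 * n + 1))%nat = 0%nat)
      by (destruct s as [| [| s]]; [exact Hz | now apply Hup0 | lia]).
    pose proof (count_above_0 _ _ _ Hzs i Hi HM). lra.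
  - assert (Hzs : dn (s + (2 * n + 1))%nat = 0%nat)
      by (destruct s as [| [| s]]; [exact Hz | now apply Hdn0 | lia]).
    pose proof (count_above_0 _ _ _ Hzs i Hi HM) as Hb. cbv beta in Hb. lra.
Qed.

Lemma infl_below (x v u : nat -> nat -> R) (hi e : R) (k r t i : nat) :
  execution E n a f T alpha M x v u -> f = 0%nat ->
  (forall s, below n M (x (s + k)%nat) hi) -> (r < n)%nat -> 0 <= e ->
  x (S k) r <= hi - e -> infl E n r t i -> x (t + S k)%nat i <= hi - rate ^ t * e.
Proof.
  intros Hex Hf Hhi Hr He Hx Hinfl.
  (* With [f = 0] there are no malicious agents, so influence passes through every node. *)
  assert (HM : forall j, (j < n)%nat -> M j = false).
  { intros j Hj. destruct (M j) eqn:HMj; [exfalso | easy].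
    destruct total as [Hc _]. rewrite Hf in Hc. apply Nat.le_0_r, length_zero_iff_nil in Hc.
    assert (HI : In j (filter M (nodes n))) by (apply filter_In; now rewrite in_nodes).
    rewrite Hc in HI. easy. }
  pose proof rate_pos as Hrate. pose proof rate_le_half.
  induction Hinfl as [| t j i Hj IH (Hjn & Hin & HE) | t j i Hj IH (Hjn & Hin & HE) | t Ht IH HN].
  - simpl. lra.
  - simpl. rewrite Rmult_assoc. rewrite <- plus_n_Sm in IH |- *.
    apply (edge_step x v u hi _ (t + k) j i); auto.
    apply (Hhi (S t)).
  - assert (x (S (S (t + S k))) i <= hi - rate * (rate ^ t * e)).
    { apply (edge_step x v u hi _ (t + S k) j i); auto.
      - rewrite <- plus_n_Sm. apply (Hhi (S t)).
      - rewrite <- plus_n_Sm. apply (Hhi (S (S t))). }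
    (* A delay of two costs only one factor [rate]; the second factor in the claim is given away, as
       [rate <= 1]. *)
    pose proof (rate_pow t). simpl.
    assert (0 <= rate ^ t * e) by (apply Rmult_le_pos; lra).
    assert (0 <= rate * (rate ^ t * e)) by (apply Rmult_le_pos; lra).
    assert (rate * (rate * (rate ^ t * e)) <= 1 * (rate * (rate ^ t * e)))
      by (apply Rmult_le_compat_r; lra).
    simpl in *. lra.
  - simpl. rewrite Rmult_assoc. rewrite <- plus_n_Sm in IH |- *.
    apply (own_step x v u hi _ (t + k) r); auto.
    apply (Hhi (S t)).
Qed.

Lemma squeezes_zero (x v u : nat -> nat -> R) :
  execution E n a f T alpha M x v u -> robust E n (f + 1) (f + 1) -> f = 0%nat ->
  exists K, squeezes x K (rate ^ K / 2).
Proof.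
  intros Hex Hrob Hf.
  assert (Hexo := execution_opp _ _ _ _ _ _ _ _ _ _ Hex).
  destruct total as [_ (i0 & Hi0 & HM0)].
  destruct (root_exists E n) as (r & Hr & Hroot); [lia | now rewrite Hf in Hrob |].
  destruct (infl_all E n r Hr Hroot) as [K HK].
  exists (S K). intros k lo hi H0 H1.
  assert (Hgap : lo <= hi) by (specialize (H0 i0 Hi0 HM0); lra).
  assert (Hhi : forall t, below n M (x (t + k)%nat) hi).
  { intros t. apply (exec_below x v u hi k t Hex).
    - intros i Hi HM. now apply H0.
    - intros i Hi HM. now apply H1. }
  assert (Hlo : forall t, below n M (fun i => - x (t + k)%nat i) (- lo)).
  { intros t. apply (exec_below _ _ _ (- lo) k t Hexo); intros i Hi HM.
    - specialize (H0 i Hi HM). lra.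
    - specialize (H1 i Hi HM). lra. }
  assert (Hpow : forall s, (s <= 1)%nat ->
    rate ^ (S K) / 2 * (hi - lo) <= rate ^ (s + K) * ((hi - lo) / 2)).
  { intros s Hs. replace (S K) with ((1 - s) + (s + K))%nat by lia.
    rewrite (pow_add rate (1 - s)).
    pose proof (rate_pow (1 - s)). pose proof (rate_pow (s + K)).
    assert (0 <= rate ^ (s + K) * ((hi - lo) / 2)) by (apply Rmult_le_pos; lra).
    nra. }
  (* The root is in the lower or the upper half of the range, and its distance of at least half the
     gap from the far end spreads to all agents. *)
  destruct (Rle_or_lt (x (S k) r) (hi - (hi - lo) / 2)) as [Hx | Hx]; [left | right];
    intros s Hs i Hi HM; specialize (Hpow s Hs);
    replace (s + S K + k)%nat with (s + K + S k)%nat by lia.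
  - assert (x (s + K + S k)%nat i <= hi - rate ^ (s + K) * ((hi - lo) / 2)); [| lra].
    apply (infl_below x v u hi _ k r); auto; [lra | apply HK; lia].
  - assert (- x (s + K + S k)%nat i <= - lo - rate ^ (s + K) * ((hi - lo) / 2)); [| lra].
    apply (infl_below _ _ _ (- lo) ((hi - lo) / 2) k r (s + K) i Hexo); auto;
      [lra | lra | apply HK; lia].
Qed.

Lemma squeezes_exists (x v u : nat -> nat -> R) :
  execution E n a f T alpha M x v u -> robust E n (f + 1) (f + 1) ->
  exists K c, 0 < c <= 1 / 2 /\ squeezes x K c.
Proof.
  intros Hex Hrob. destruct (Nat.eq_dec f 0) as [Hf | Hf].
  - destruct (squeezes_zero x v u Hex Hrob Hf) as [K HK].
    exists K, (rate ^ K / 2). split; [pose proof (rate_pow K); lra | easy].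
  - exists (2 * n + 2)%nat, (rate ^ (2 * n + 2) / 2).
    split; [pose proof (rate_pow (2 * n + 2)); lra |].
    apply (squeezes_pos x v u Hex Hrob). lia.
Qed.

(** * Safety, vanishing gap and agreement *)

Lemma exec_within (x v u : nat -> nat -> R) (lo hi : R) (k t : nat) :
  execution E n a f T alpha M x v u -> (k <= t)%nat ->
  within n M (x k) lo hi -> within n M (x (S k)) lo hi -> within n M (x t) lo hi.
Proof.
  intros Hex Hkt H0 H1 i Hi HM.
  assert (Hexo := execution_opp _ _ _ _ _ _ _ _ _ _ Hex).
  replace t with (t - k + k)%nat by lia. split.
  - apply Ropp_le_cancel.
    apply (exec_below _ _ _ (- lo) k (t - k) Hexo); auto; intros j Hj HMj.
    + specialize (H0 j Hj HMj). lra.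
    + specialize (H1 j Hj HMj). lra.
  - apply (exec_below x v u hi k (t - k) Hex); auto; intros j Hj HMj.
    + specialize (H0 j Hj HMj). lra.
    + specialize (H1 j Hj HMj). lra.
Qed.

Lemma gap_vanishes (x v u : nat -> nat -> R) (lo hi eps : R) :
  execution E n a f T alpha M x v u -> robust E n (f + 1) (f + 1) ->
  within n M (x 0%nat) lo hi -> within n M (x 1%nat) lo hi -> 0 < eps ->
  exists k lo' hi', hi' - lo' < eps /\ forall t, (k <= t)%nat -> within n M (x t) lo' hi'.
Proof.
  intros Hex Hrob H0 H1 Heps.
  destruct (squeezes_exists x v u Hex Hrob) as (K & c & Hc & HK).
  assert (Hgap : lo <= hi).
  { destruct total as [_ (i & Hi & HM)]. specialize (H0 i Hi HM). lra. }
  assert (Hiter : forall m, exists k lo' hi', hi' - lo' <= (1 - c) ^ m * (hi - lo) /\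
    within n M (x k) lo' hi' /\ within n M (x (S k)) lo' hi').
  { induction m as [| m (k & lo' & hi' & Hg & Hk0 & Hk1)].
    - exists 0%nat, lo, hi. simpl. repeat split; try apply H0; try apply H1; auto; lra.
    - assert (Hg' : hi' - lo' - c * (hi' - lo') <= (1 - c) ^ S m * (hi - lo)).
      { simpl. replace (hi' - lo' - c * (hi' - lo')) with ((1 - c) * (hi' - lo')) by ring.
        rewrite Rmult_assoc. apply Rmult_le_compat_l; lra. }
      assert (Hlate : forall s, within n M (x (s + K + k)%nat) lo' hi').
      { intros s. apply (exec_within x v u lo' hi' k); auto. lia. }
      destruct (HK k lo' hi' Hk0 Hk1) as [Hs | Hs].
      + exists (K + k)%nat, lo', (hi' - c * (hi' - lo')). split; [lra |].
        split; intros i Hi HM.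
        * specialize (Hs 0%nat ltac:(lia) i Hi HM). specialize (Hlate 0%nat i Hi HM).
          simpl in *. lra.
        * specialize (Hs 1%nat ltac:(lia) i Hi HM). specialize (Hlate 1%nat i Hi HM).
          simpl in *. lra.
      + exists (K + k)%nat, (lo' + c * (hi' - lo')), hi'. split; [lra |].
        split; intros i Hi HM.
        * specialize (Hs 0%nat ltac:(lia) i Hi HM). specialize (Hlate 0%nat i Hi HM).
          simpl in *. lra.
        * specialize (Hs 1%nat ltac:(lia) i Hi HM). specialize (Hlate 1%nat i Hi HM).
          simpl in *. lra. }
  (* The added 1 keeps the denominator positive when [lo = hi]. *)
  destruct (pow_lt_1_zero (1 - c)) with (y := eps / (hi - lo + 1)) as [N HN].
  { rewrite Rabs_pos_eq; lra. }
  { apply Rdiv_lt_0_compat; lra. }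
  destruct (Hiter N) as (k & lo' & hi' & Hg & Hk0 & Hk1).
  exists k, lo', hi'. split.
  - specialize (HN N (Nat.le_refl N)).
    assert (Hp : 0 < (1 - c) ^ N) by (apply pow_lt; lra).
    rewrite Rabs_pos_eq in HN by lra.
    apply Rle_lt_trans with (1 := Hg).
    apply Rle_lt_trans with ((1 - c) ^ N * (hi - lo + 1)); [nra |].
    apply Rmult_lt_compat_r with (r := hi - lo + 1) in HN; [| lra].
    replace (eps / (hi - lo + 1) * (hi - lo + 1)) with eps in HN by (field; lra). exact HN.
  - intros t Ht. apply (exec_within x v u lo' hi' k); auto.
Qed.

(** A large velocity would carry the agent out of the range in one step, by [next_position_le] for
    the run and its mirror image. The factor is positive because [alpha * T < 2]. *)
Lemma velocity_le (x v u : nat -> nat -> R) (lo hi : R) (k i : nat) :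
  execution E n a f T alpha M x v u -> (i < n)%nat -> M i = false ->
  within n M (x k) lo hi -> within n M (x (S k)) lo hi ->
  (T - alpha * T ^ 2 / 2) * Rabs (v k i) <= hi - lo.
Proof.
  intros Hex Hi HM H0 H1.
  assert (Hkappa : 0 < T - alpha * T ^ 2 / 2).
  { pose proof (pow_lt T 2 T_pos). simpl in *. nra. }
  pose proof (execution_opp _ _ _ _ _ _ _ _ _ _ Hex) as [Hdyno [selo Hctrlo]].
  destruct Hex as [Hdyn [sel Hctrl]].
  assert (Hup := next_position_le x v u sel Hdyn Hctrl hi k i).
  assert (Hdn := next_position_le _ _ _ selo Hdyno Hctrlo (- lo) k i).
  cbv beta in Hdn.
  assert (Hb : below n M (x k) hi) by (intros j Hj HMj; now apply H0).
  assert (Hb' : below n M (fun i => - x k i) (- lo)).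
  { intros j Hj HMj. specialize (H0 j Hj HMj). lra. }
  specialize (Hup Hb Hi HM). specialize (Hdn Hb' Hi HM). specialize (H1 i Hi HM).
  unfold Rabs. destruct (Rcase_abs (v k i)); lra.
Qed.

(** The recursion has order two, so both times 0 and 1 are needed to start the invariance of the
    interval. *)
Lemma initial_within (x v u : nat -> nat -> R) :
  execution E n a f T alpha M x v u ->
  within n M (x 0%nat) (S_lo n T alpha M (x 0%nat) (v 0%nat)) (S_hi n T alpha M (x 0%nat) (v 0%nat)) /\
  within n M (x 1%nat) (S_lo n T alpha M (x 0%nat) (v 0%nat)) (S_hi n T alpha M (x 0%nat) (v 0%nat)).
Proof.
  intros Hex. unfold S_lo, S_hi.
  set (xl := map (x 0%nat) (normals n M)).
  set (vl := map (fun i => (T - alpha * T ^ 2 / 2) * v 0%nat i) (normals n M)).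
  assert (Hn : forall i, (i < n)%nat -> M i = false -> In i (normals n M)).
  { intros i Hi HM. apply filter_In. now rewrite in_nodes, HM. }
  assert (Hx : forall i, (i < n)%nat -> M i = false -> Rmin_list xl <= x 0%nat i <= Rmax_list xl).
  { intros i Hi HM. split; [apply Rmin_list_le | apply Rmax_list_ge]; apply in_map; auto. }
  assert (Hv : forall i, (i < n)%nat -> M i = false ->
    Rmin_list vl <= (T - alpha * T ^ 2 / 2) * v 0%nat i <= Rmax_list vl).
  { intros i Hi HM. split; [apply Rmin_list_le | apply Rmax_list_ge];
      apply (in_map (fun i => (T - alpha * T ^ 2 / 2) * v 0%nat i)); auto. }
  assert (Hm0 := Rmin_l 0 (Rmin_list vl)). assert (Hm1 := Rmin_r 0 (Rmin_list vl)).
  assert (HM0 := Rmax_l 0 (Rmax_list vl)). assert (HM1 := Rmax_r 0 (Rmax_list vl)).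
  pose proof (execution_opp _ _ _ _ _ _ _ _ _ _ Hex) as [Hdyno [selo Hctrlo]].
  destruct Hex as [Hdyn [sel Hctrl]].
  split; intros i Hi HM; specialize (Hx i Hi HM) as Hxi; specialize (Hv i Hi HM).
  - lra.
  - assert (Hup := next_position_le x v u sel Hdyn Hctrl (Rmax_list xl) 0 i
      (fun j Hj HMj => proj2 (Hx j Hj HMj)) Hi HM).
    assert (Hdn := next_position_le _ _ _ selo Hdyno Hctrlo (- Rmin_list xl) 0 i
      (fun j Hj HMj => Ropp_le_contravar _ _ (proj1 (Hx j Hj HMj))) Hi HM).
    cbv beta in Hdn. lra.
Qed.

Lemma exec_agreement (x v u : nat -> nat -> R) (lo hi : R) :
  execution E n a f T alpha M x v u -> robust E n (f + 1) (f + 1) ->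
  within n M (x 0%nat) lo hi -> within n M (x 1%nat) lo hi ->
  exists c, lo <= c <= hi /\
    forall i, (i < n)%nat -> M i = false ->
      Un_cv (fun k => x k i) c /\ Un_cv (fun k => v k i) 0.
Proof.
  intros Hex Hrob H0 H1.
  assert (Hgap := fun eps => gap_vanishes x v u lo hi eps Hex Hrob H0 H1).
  destruct total as [_ (i0 & Hi0 & HM0)].
  (* One normal agent is shown to be Cauchy; the others share its limit because the gap vanishes. *)
  destruct (R_complete (fun k => x k i0)) as [c Hc].
  { intros eps Heps. destruct (Hgap eps Heps) as (k & lo' & hi' & Hg & Hw).
    exists k. intros p q Hp Hq. specialize (Hw p Hp i0 Hi0 HM0) as Hwp.
    specialize (Hw q Hq i0 Hi0 HM0). unfold Rdist. apply Rabs_def1; lra. }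
  exists c. split.
  - assert (Hall : forall k, lo <= x k i0 <= hi).
    { intros k. apply (exec_within x v u lo hi 0 k Hex); auto. lia. }
    destruct (Rle_or_lt lo c) as [Hl | Hl], (Rle_or_lt c hi) as [Hh | Hh]; [easy | exfalso ..].
    + destruct (Hc (c - hi)) as [N HN]; [lra |]. specialize (HN N (Nat.le_refl N)).
      specialize (Hall N). unfold Rdist in HN. apply Rabs_def2 in HN. lra.
    + destruct (Hc (lo - c)) as [N HN]; [lra |]. specialize (HN N (Nat.le_refl N)).
      specialize (Hall N). unfold Rdist in HN. apply Rabs_def2 in HN. lra.
    + specialize (Hall 0%nat). lra.
  - intros i Hi HM. split.
    + intros eps Heps. destruct (Hgap (eps / 2)) as (k & lo' & hi' & Hg & Hw); [lra |].
      destruct (Hc (eps / 2)) as [N HN]; [lra |].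
      exists (Nat.max k N). intros p Hp.
      specialize (HN p ltac:(lia)). specialize (Hw p ltac:(lia)).
      specialize (Hw i Hi HM) as Hwi. specialize (Hw i0 Hi0 HM0).
      unfold Rdist in *. apply Rabs_def2 in HN. apply Rabs_def1; lra.
    + intros eps Heps. set (kappa := T - alpha * T ^ 2 / 2).
      assert (Hkappa : 0 < kappa).
      { unfold kappa. pose proof (pow_lt T 2 T_pos). simpl in *. nra. }
      destruct (Hgap (kappa * eps)) as (k & lo' & hi' & Hg & Hw).
      { now apply Rmult_lt_0_compat. }
      exists k. intros p Hp.
      assert (Hv := velocity_le x v u lo' hi' p i Hex Hi HM (Hw p Hp) (Hw (S p) ltac:(lia))).
      fold kappa in Hv. unfold Rdist. rewrite Rminus_0_r.
      apply Rmult_lt_reg_l with kappa; lra.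
Qed.

End Run.

Lemma robust_consensus (E : nat -> nat -> bool) (n f : nat) (gamma : R) (a : nat -> nat -> R)
    (T alpha : R) :
  weights_ok E n gamma a -> 0 < T -> 1 + T ^ 2 / 2 <= alpha * T <= 2 - T ^ 2 / 2 ->
  robust E n (f + 1) (f + 1) ->
  res_consensus_with E n a f T alpha (S_lo n T alpha) (S_hi n T alpha).
Proof.
  intros Hw HT Hg Hrob M Hf x v u Hex.
  destruct (initial_within E n f gamma a T alpha Hw HT Hg M Hf x v u Hex) as [H0 H1].
  split.
  - intros k i Hi HM.
    apply (exec_within E n f gamma a T alpha Hw HT Hg M Hf x v u _ _ 0 k Hex); auto. lia.
  - now apply (exec_agreement E n f gamma a T alpha Hw HT Hg M Hf x v u).
Qed.

(** * Necessity of robustness *)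

Lemma exists_max (key : nat -> R) (l : list nat) :
  l <> nil -> exists y, In y l /\ forall z, In z l -> key z <= key y.
Proof.
  induction l as [| w l IH]; [easy |]. intros _.
  destruct l as [| w' l'].
  - exists w. split; [now left |]. intros z [<- | []]. lra.
  - destruct IH as (y & Hy & Hmax); [easy |].
    destruct (Rle_or_lt (key w) (key y)) as [Hle | Hlt].
    + exists y. split; [now right |]. intros z [<- | Hz]; auto.
    + exists w. split; [now left |]. intros z [<- | Hz]; [lra |].
      specialize (Hmax z Hz). lra.
Qed.

(** Greedy selection: a maximum of the members not yet chosen is added, [m] times or until the list
    is used up. *)
Lemma exists_top (key : nat -> R) (l : list nat) (m : nat) :
  NoDup l ->
  exists up : nat -> bool,
    (forall j, up j = true -> In j l) /\
    length (filter up l) = Nat.min m (length l) /\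
    (forall j j', In j l -> In j' l -> up j = true -> up j' = false -> key j' <= key j).
Proof.
  intros Hl. induction m as [| m (up & Hin & Hlen & Htop)].
  - exists (fun _ => false). repeat split; [easy | | easy].
    induction l; [easy |]. simpl. apply IHl. now inversion Hl.
  - destruct (le_lt_dec (length l) m) as [Hle | Hlt].
    { exists up. repeat split; auto. lia. }
    destruct (exists_max key (filter (fun j => negb (up j)) l)) as (y & Hy & Hmax).
    { intros Hnil. pose proof (filter_length up l) as Hs. rewrite Hnil in Hs. simpl in Hs. lia. }
    apply filter_In in Hy as [Hy Hupy]. apply negb_true_iff in Hupy.
    exists (fun j => up j || Nat.eqb j y). repeat split.
    + intros j Hj. apply orb_true_iff in Hj as [Hj | Hj]; [auto |].
      apply Nat.eqb_eq in Hj. now subst.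
    + assert (Hone : (length (filter (fun j => Nat.eqb j y) l) <= 1)%nat).
      { apply (NoDup_incl_length (l' := y :: nil)); [now apply NoDup_filter |].
        intros z Hz. apply filter_In in Hz as [_ Hz]. apply Nat.eqb_eq in Hz. now left. }
      pose proof (filter_length_orb _ up (fun j => Nat.eqb j y) l).
      assert (length (filter up l) < length (filter (fun j => up j || Nat.eqb j y) l))%nat.
      { apply filter_length_incl_lt with (y := y); auto.
        - intros z Hz Hu. now rewrite Hu.
        - rewrite Nat.eqb_refl. apply orb_true_r. }
      lia.
    + intros j j' Hj Hj' Hu Hu'. apply orb_false_iff in Hu' as [Hu' _].
      apply orb_true_iff in Hu as [Hu | Hu]; [auto |].
      apply Nat.eqb_eq in Hu. subst j. apply Hmax. apply filter_In. now rewrite Hu'.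
Qed.

Lemma exists_dpmsr_ignore (E : nat -> nat -> bool) (n f : nat) (xk : nat -> R) (i : nat) :
  exists ign, dpmsr_ignore E n f xk i ign.
Proof.
  unfold dpmsr_ignore. cbv zeta.
  set (Pl := filter (fun h => Rleb 0 (xk h - xk i)) (nbrs E n i)).
  set (Ll := filter (fun h => Rleb (xk h - xk i) 0) (nbrs E n i)).
  destruct (exists_top (fun j => xk j - xk i) Pl f) as (up & Hup & Hupn & Huptop).
  { apply NoDup_filter, NoDup_nbrs. }
  destruct (exists_top (fun j => - (xk j - xk i)) Ll f) as (lo & Hlo & Hlon & Hlotop).
  { apply NoDup_filter, NoDup_nbrs. }
  exists (fun j => up j || lo j), up, lo. repeat split; auto.
  intros j j' Hj Hj' H1 H2. specialize (Hlotop j j' Hj Hj' H1 H2). cbv beta in Hlotop. lra.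
Qed.

(** The necessity proof needs an actual run. The rule leaves ties open, so a choice principle picks
    the ignored sets. *)
Lemma exists_execution (E : nat -> nat -> bool) (n : nat) (a : nat -> nat -> R) (f : nat)
    (T alpha : R) (M : nat -> bool) (x0 : nat -> R) :
  exists x v u, execution E n a f T alpha M x v u /\
    (forall i, x 0%nat i = x0 i) /\ (forall i, v 0%nat i = 0) /\
    (forall k i, M i = true -> u k i = 0).
Proof.
  set (sel := fun xk i =>
    proj1_sig (constructive_indefinite_description _ (exists_dpmsr_ignore E n f xk i))).
  set (ctl := fun (xk vk : nat -> R) i =>
    if M i then 0
    else - sumR (map (fun j => (if sel xk i j then 0 else a i j) * (xk i - xk j)) (nbrs E n i))
         - alpha * vk i).
  set (st := nat_rect (fun _ => ((nat -> R) * (nat -> R))%type) (x0, fun _ => 0)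
    (fun _ s => (fun i => fst s i + T * snd s i + T ^ 2 / 2 * ctl (fst s) (snd s) i,
                 fun i => snd s i + T * ctl (fst s) (snd s) i))).
  exists (fun k => fst (st k)), (fun k => snd (st k)), (fun k => ctl (fst (st k)) (snd (st k))).
  repeat split.
  - exists (fun k => sel (fst (st k))). intros k i Hi HM. split.
    + unfold sel. apply proj2_sig.
    + unfold ctl. now rewrite HM.
  - intros k i HM. unfold ctl. now rewrite HM.
Qed.

(* A normal node of [S] outside [Xr] has at most [f] neighbours off [S], and ignores them all. *)
Lemma stays_constant (E : nat -> nat -> bool) (n : nat) (a : nat -> nat -> R) (f : nat)
    (T alpha : R) (M S : nat -> bool) (x v u : nat -> nat -> R) (c : R) :
  execution E n a f T alpha M x v u ->
  (forall k i, M i = true -> u k i = 0) ->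
  (forall i, (i < n)%nat -> S i = true -> M i = false -> Xr E n (f + 1) S i = false) ->
  (forall i, (i < n)%nat -> S i = true -> x 0%nat i = c /\ v 0%nat i = 0) ->
  forall k i, (i < n)%nat -> S i = true -> x k i = c /\ v k i = 0.
Proof.
  intros [Hdyn [sel Hctrl]] Hmal HX Hinit. induction k as [| k IH]; [exact Hinit |].
  intros i Hi HS. destruct (IH i Hi HS) as [Hx Hv].
  assert (Hu : u k i = 0).
  { destruct (M i) eqn:HM; [now apply Hmal |].
    destruct (Hctrl k i Hi HM) as [Hd ->]. rewrite Hv.
    rewrite sumR_map_zero; [ring |].
    intros j Hj. destruct (sel k i j) eqn:Hs; [ring |].
    rewrite (kept_eq E n f (x k) i (sel k i) (fun j => negb (S j)) Hd) with (j := j); auto; [ring | |].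
    - intros h Hh Hb. apply negb_false_iff in Hb. apply in_nbrs in Hh as [Hh _].
      rewrite Hx. now apply IH.
    - specialize (HX i Hi HS HM). unfold Xr in HX. rewrite HS in HX. simpl in HX.
      apply Nat.leb_gt in HX.
      apply Nat.le_trans with (out_in_count E n S i); [| lia].
      apply filter_length_incl; [apply NoDup_nbrs |].
      intros h Hh Hb. apply in_nbrs in Hh as [Hh HE]. rewrite in_nodes, HE. easy. }
  destruct (Hdyn k i Hi) as [-> ->]. rewrite Hx, Hv, Hu. split; ring.
Qed.

Lemma Un_cv_const (U : nat -> R) (b l : R) : (forall k, U k = b) -> Un_cv U l -> l = b.
Proof.
  intros HU Hcv. apply (UL_sequence U); [exact Hcv |].
  intros eps Heps. exists 0%nat. intros k _. rewrite HU. unfold Rdist.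
  rewrite Rminus_diag, Rabs_R0. lra.
Qed.

Lemma consensus_robust (E : nat -> nat -> bool) (n f : nat) (a : nat -> nat -> R) (T alpha : R) :
  res_consensus E n a f T alpha -> robust E n (f + 1) (f + 1).
Proof.
  intros (lo & hi & _ & _ & Hres) S1 S2 HS1 HS2 Hdisj.
  apply NNPP. intros Hno. apply not_or_and in Hno as [Hno1 Hno].
  apply not_or_and in Hno as [Hno2 Hno3].
  assert (Hbad : forall S, ~ (forall i, (i < n)%nat -> S i = true -> Xr E n (f + 1) S i = true) ->
    exists i, (i < n)%nat /\ S i = true /\ Xr E n (f + 1) S i = false).
  { intros S HS. apply not_all_ex_not in HS as [i HS].
    apply imply_to_and in HS as [Hi HS]. apply imply_to_and in HS as [HSi HS].
    exists i. repeat split; auto. now apply not_true_is_false. }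
  destruct (Hbad S1 Hno1) as (i1 & Hi1 & HSi1 & HX1).
  destruct (Hbad S2 Hno2) as (i2 & Hi2 & HSi2 & HX2).
  set (M := fun i => Xr E n (f + 1) S1 i || Xr E n (f + 1) S2 i).
  assert (HX : forall S i, S i = false -> Xr E n (f + 1) S i = false).
  { intros S i HS. unfold Xr. now rewrite HS. }
  assert (HS21 : forall i, (i < n)%nat -> S2 i = true -> S1 i = false).
  { intros i Hi HS. destruct (S1 i) eqn:H1; [| easy]. rewrite Hdisj in HS; easy. }
  (* Disjointness keeps [i1] out of [S2] and [i2] out of [S1], so both witnesses are normal. *)
  assert (HM1 : M i1 = false) by (unfold M; rewrite HX1; apply HX; auto).
  assert (HM2 : M i2 = false) by (unfold M; rewrite HX2, HX; auto).
  (* Failure of the counting alternative bounds the number of malicious agents by [f]. *)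
  assert (Htot : f_total n f M).
  { split; [| eauto].
    pose proof (filter_length_orb _ (Xr E n (f + 1) S1) (Xr E n (f + 1) S2) (nodes n)).
    unfold card in *. fold M in H. lia. }
  destruct (exists_execution E n a f T alpha M (fun i => if S1 i then 1 else 0))
    as (x & v & u & Hex & Hx0 & Hv0 & Hu0).
  destruct (Hres M Htot x v u Hex) as [_ (c & _ & Hcv)].
  assert (Hc1 : c = 1).
  { apply Un_cv_const with (U := fun k => x k i1); [| now apply Hcv].
    intros k. apply (stays_constant E n a f T alpha M S1 x v u 1); auto.
    - intros i Hi HS HM. unfold M in HM. now apply orb_false_iff in HM.
    - intros i Hi HS. rewrite Hx0, HS. auto. }
  assert (Hc2 : c = 0).
  { apply Un_cv_const with (U := fun k => x k i2); [| now apply Hcv].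
    intros k. apply (stays_constant E n a f T alpha M S2 x v u 0); auto.
    - intros i Hi HS HM. unfold M in HM. now apply orb_false_iff in HM.
    - intros i Hi HS. rewrite Hx0, HS21; auto. }
  lra.
Qed.

(** * The interval depends on normal agents only; the equivalence *)

Lemma depends_on_normal_S_lo (n : nat) (T alpha : R) : depends_on_normal n (S_lo n T alpha).
Proof.
  intros M x0 x0' v0 v0' H. unfold S_lo.
  assert (HN : forall i, In i (normals n M) -> x0 i = x0' i /\ v0 i = v0' i).
  { intros i Hi. apply filter_In in Hi as [Hi HM]. apply in_nodes in Hi.
    apply negb_true_iff in HM. auto. }
  rewrite (map_ext_in x0 x0') by (intros; now apply HN).
  rewrite (map_ext_in (fun i => (T - alpha * T ^ 2 / 2) * v0 i)
                      (fun i => (T - alpha * T ^ 2 / 2) * v0' i)); [easy |].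
  intros i Hi. f_equal. now apply HN.
Qed.

Lemma depends_on_normal_S_hi (n : nat) (T alpha : R) : depends_on_normal n (S_hi n T alpha).
Proof.
  intros M x0 x0' v0 v0' H. unfold S_hi.
  assert (HN : forall i, In i (normals n M) -> x0 i = x0' i /\ v0 i = v0' i).
  { intros i Hi. apply filter_In in Hi as [Hi HM]. apply in_nodes in Hi.
    apply negb_true_iff in HM. auto. }
  rewrite (map_ext_in x0 x0') by (intros; now apply HN).
  rewrite (map_ext_in (fun i => (T - alpha * T ^ 2 / 2) * v0 i)
                      (fun i => (T - alpha * T ^ 2 / 2) * v0' i)); [easy |].
  intros i Hi. f_equal. now apply HN.
Qed.

Theorem theorem1 (f n : nat) (E : nat -> nat -> bool) (gamma : R) (a : nat -> nat -> R)
    (T alpha : R) :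
  digraph_ok E n ->
  weights_ok E n gamma a ->
  0 < T -> 0 < alpha ->
  1 + T ^ 2 / 2 <= alpha * T <= 2 - T ^ 2 / 2 ->
  (res_consensus E n a f T alpha <-> robust E n (f + 1) (f + 1)) /\
  (robust E n (f + 1) (f + 1) ->
     res_consensus_with E n a f T alpha (S_lo n T alpha) (S_hi n T alpha)).
Proof.
  intros _ Hw HT _ Hg.
  assert (Hsuff := robust_consensus E n f gamma a T alpha Hw HT Hg).
  split; [split |]; auto.
  - apply consensus_robust.
  - intros Hrob. exists (S_lo n T alpha), (S_hi n T alpha).
    auto using depends_on_normal_S_lo, depends_on_normal_S_hi.
Qed.
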